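(* Let $G$ be a locally finite transitive graph for which there exists $k\in\mathbb N$ such that the cycle space of $G$ is generated (as a vector space over $\mathbb F_2$) by cycles of length at most $k$. Then $G$ is accessible.
   Context: A graph $G$ is transitive if its automorphism group acts transitively on $V(G)$. The sum (over $\mathbb F_2$) of finitely many (finite) cycles $(C_i)_{i\in I}$ in $G$ is the subgraph induced by those edges that occur in an odd number of the $C_i$. The set of all sums of finitely many cycles in $G$ is a vector space over $\mathbb F_2$, the cycle space of $G$. A ray is a one-way infinite path. Two rays are equivalent if, for every finite edge set $F\subseteq E(G)$, they lie eventually in the same component of $G-F$. The equivalence classes are the (edge) ends of $G$. An edge set $F\subseteq E(G)$ separates two ends if the rays of these ends lie eventually in different components of $G-F$. A graph $G$ is accessible if there exists $k\in\mathbb N$ such that any two distinct ends of $G$ can be separated by at most $k$ edges. *)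

(* Defs.v *)
From HB Require Import structures.
From Stdlib Require Import Relation_Operators.
From mathcomp Require Import all_boot all_order all_algebra.
From mathcomp Require Import boolp classical_sets functions cardinality.

Set Implicit Arguments.
Unset Strict Implicit.
Unset Printing Implicit Defensive.

Import GRing.Theory.
Local Open Scope classical_set_scope.
Local Open Scope card_scope.
Local Open Scope ring_scope.

Record sgraph (V : Type) := SGraph {
  adj :> V -> V -> Prop;
  adj_sym : forall x y, adj x y -> adj y x;
  adj_irrefl : forall x, ~ adj x x }.

Section Graph.
Variables (V : Type) (G : sgraph V).

(* An edge is the unordered pair [set x; y] of its ends. *)
Definition edges : set (set V) :=
  [set e | exists x y, G x y /\ e = [set x; y]].

Definition locally_finite : Prop := forall x, finite_set [set y | G x y].

Definition automorphism (f : V -> V) : Prop :=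
  bijective f /\ forall x y, G (f x) (f y) <-> G x y.

Definition transitive_graph : Prop :=
  forall x y, exists f, automorphism f /\ f x = y.

(* [c 0, ..., c (n - 1)] in cyclic order; [ordS i] is [i + 1] modulo [n]. *)
Definition is_cycle (n : nat) (C : set (set V)) : Prop :=
  (3 <= n)%N /\
  exists c : 'I_n -> V,
    [/\ injective c, forall i, G (c i) (c (ordS i))
      & C = [set [set c i; c (ordS i)] | i in [set: 'I_n]]].

(* A subgraph induced by a set of edges is identified with that edge set. *)
Definition edge_sum (m : nat) (C : 'I_m -> set (set V)) : set (set V) :=
  [set e | odd #|[set i | e \in C i]%SET|].

(* Edge sets as vectors over the field with two elements: this turns symmetric
   difference into addition, see [edge_vec_sum]. *)
Definition edge_vec (D : set (set V)) : set V -> ('F_2)^o :=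
  fun e => (e \in D)%:R.

Lemma edge_vec_sum (m : nat) (C : 'I_m -> set (set V)) :
  edge_vec (edge_sum C) = \sum_(i < m) edge_vec (C i).
Proof.
apply/funext => e; rewrite fct_sumE /edge_vec -natr_sum.
have -> : (\sum_(i < m) (e \in C i))%N = #|[set i | e \in C i]%SET|.
  rewrite -sum1_card [RHS]big_mkcond /=; apply: eq_bigr => i _.
  by rewrite inE; case: (e \in C i).
set k := #|_|.
have -> : (e \in edge_sum C) = odd k.
  by apply/idP/idP; rewrite in_setE.
rewrite -[in RHS](odd_double_half k) natrD -muln2 natrM.
by rewrite (_ : 2%:R = 0 :> 'F_2) ?mulr0 ?addr0 //; apply/val_inj.
Qed.

Lemma edge_vec_inj : injective edge_vec.
Proof.
move=> A B AB; apply/seteqP; split => e He; have := congr1 (@^~ e) AB;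
  rewrite /edge_vec (mem_set He).
- by case: (boolP (e \in B)) => [|_ /eqP //]; rewrite in_setE.
- by case: (boolP (e \in A)) => [|_ /eqP //]; rewrite in_setE.
Qed.

Definition cycle_space : set (set V -> ('F_2)^o) :=
  [set v | exists (m : nat) (C : 'I_m -> set (set V)),
     (forall i, exists n, is_cycle n (C i)) /\ v = edge_vec (edge_sum C)].

Definition short_cycles (k : nat) : set (set V -> ('F_2)^o) :=
  [set v | exists n C, [/\ (n <= k)%N, is_cycle n C & v = edge_vec C]].

Definition component (F : set (set V)) (x : V) : set V :=
  [set y | clos_refl_trans V (fun a b => G a b /\ ~ F [set a; b]) x y].

(* [K] is the vertex set of a component of [G - F]. *)
Definition is_component (F : set (set V)) (K : set V) : Prop :=
  exists x, K = component F x.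

Definition is_ray (r : nat -> V) : Prop :=
  injective r /\ forall n, G (r n) (r n.+1).

Definition eventually_in (r : nat -> V) (K : set V) : Prop :=
  exists N, forall n, (N <= n)%N -> K (r n).

Definition ray_equiv (r s : nat -> V) : Prop :=
  forall F, F `<=` edges -> finite_set F ->
    exists K, [/\ is_component F K, eventually_in r K & eventually_in s K].

Definition is_end (w : set (nat -> V)) : Prop :=
  exists2 r, is_ray r & w = [set s | is_ray s /\ ray_equiv r s].

Definition separates (F : set (set V)) (w w' : set (nat -> V)) : Prop :=
  forall r s, w r -> w' s ->
    exists K L, [/\ is_component F K, is_component F L, K <> L,
      eventually_in r K & eventually_in s L].

Definition accessible : Prop :=
  exists k : nat, forall w w', is_end w -> is_end w' -> w <> w' ->
    exists F, [/\ F `<=` edges, F #<= `I_k & separates F w w'].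

End Graph.

Definition linear_span (K : fieldType) (M : lmodType K) (S : set M) : set M :=
  [set v | exists (m : nat) (a : 'I_m -> K) (x : 'I_m -> M),
     (forall i, S (x i)) /\ v = \sum_(i < m) a i *: x i].

(* Main.v *)
Require Import Defs.
From Stdlib Require Import Relation_Operators.
From mathcomp Require Import all_boot all_order all_algebra finmap.
From mathcomp Require Import boolp classical_sets functions cardinality.

(** Call the number of edges of a cheapest edge cut between two ends their
distance; a cut attaining it is efficient. The graph is accessible exactly when
the sizes of efficient cuts are bounded, and the proof bounds the number of
these sizes.

An efficient cut of a connected graph is a bond ([efficient_bond]), and only
finitely many bonds of bounded size cross a given one
([finite_crossing_bonds]). If two efficient cuts cross, submodularity of the
boundary size makes two opposite corners efficient cuts of the same two sizes
([efficient_corners]), and these corners are crossed by fewer cuts in total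
([crossing_number_corners]). So the efficient cuts of size at most [M] that
minimize, within their size, the number of crossings with efficient cuts of
size at most [M] form a nested family, invariant under automorphisms, in which
every size of an efficient cut up to [M] is still represented
([optimal_cuts_nested], [optimal_cut_exists]).

The optimal cuts through a given edge form a finite chain. Let [P] be the
predecessor of [S] in such a chain. Since [P] and [S] are distinct bonds, the
set of their common edges is not a cut. Because short cycles generate the cycle
space, a set of edges that is a cut in every ball of a fixed radius is a cut
([short_cycles_local_cuts]). Hence some ball of that radius contains a common
edge of [P] and [S] together with a vertex that lies in [S] but not in [P]
([marked_gap_somewhere]). By transitivity the ball can be moved to a fixed
ball [B], and there the traces of [P] and [S] on [B] determine [S]: a second
such pair with the same traces would be in the same chain, and one of the two
larger cuts would lie below the predecessor of the other ([gap_trace_inj]). So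
the number of sizes is at most the number of pairs of subsets of [B], whatever
[M] is ([bounded_splitting]). This is the counting step of Dunwoody's
accessibility theorem with traces on a ball in place of patterns in a complex.

The graph may be disconnected. The argument runs inside one component, to which
rays are moved by an automorphism; ends in different components are separated
by the empty set. *)

Set Implicit Arguments.
Unset Strict Implicit.
Unset Printing Implicit Defensive.

Local Open Scope classical_set_scope.

(** * Cardinals of finite sets as natural numbers *)

(** The value is meaningful on finite sets only. *)
Definition card (T : Type) (A : set T) : nat :=
  #|` fset_set (A : set {classic T})|.

Lemma card_count (T : Type) (A : set T) (U : {fset {classic T}}) :
  A `<=` [set` U] -> card A = \sum_(p <- U) `[< A p >].
Proof.
move=> sAU; have fA : finite_set (A : set {classic T}).
  exact: sub_finite_set sAU (finite_fset U).
transitivity (count (fun p => `[< A p >]) U); last first.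
  by rewrite -sum1_count big_mkcond; apply: eq_bigr => p _; case: asbool.
rewrite /card -size_filter; apply: perm_size.
apply: uniq_perm; rewrite ?filter_uniq ?fset_uniq // => p.
rewrite mem_filter in_fset_set //; apply/idP/andP => [/set_mem Ap|[/asboolP Ap _]];
  last exact: mem_set.
by split; [exact/asboolP | exact: sAU].
Qed.

(** Submodularity of the boundary size and the decrease of crossing numbers under
uncrossing are instances; [E] serves to make the inequality strict. *)
Lemma leq_card2 (T : Type) (A B E C D : set T) :
  finite_set C -> finite_set D ->
  (forall p,
     `[< A p >] + `[< B p >] + `[< E p >] <= `[< C p >] + `[< D p >]) ->
  card A + card B + card E <= card C + card D.
Proof.
move=> fC fD H.
have fCD : finite_set ((C `|` D) : set {classic T}) by rewrite finite_setU.
pose U := fset_set ((C `|` D) : set {classic T}).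
have UE : [set` U] = C `|` D by rewrite fset_setK.
have sub (X : set T) : X `<=` C `|` D -> X `<=` [set` U] by rewrite UE.
have sABE : [/\ A `<=` C `|` D, B `<=` C `|` D & E `<=` C `|` D].
  split=> p Xp; have := H p; rewrite (asboolT Xp);
    (case: (asboolP (C p)) => [Cp _|_]; first by left);
    (case: (asboolP (D p)) => [Dp _|_]; first by right);
    by rewrite ?addn1 ?addnS ?add0n.
have [sA sB sE] := sABE.
rewrite !(@card_count _ _ U); try (apply: sub => // p Xp; by [left|right]).
by rewrite -!big_split /=; apply: leq_sum => p _.
Qed.

Lemma card_set0 (T : Type) : card (@set0 T) = 0.
Proof. by rewrite /card fset_set0 cardfs0. Qed.

Lemma card_set1 (T : Type) (x : T) : card [set x] = 1.
Proof. by rewrite /card (fset_set1 (x : {classic T})) cardfs1. Qed.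

Lemma leq_finite_card (T : Type) (A C : set T) :
  finite_set C -> A `<=` C -> card A <= card C.
Proof.
move=> fC sAC; have := @leq_card2 _ A set0 set0 C set0 fC (@finite_set0 _).
rewrite card_set0 !addn0; apply=> p.
have -> : `[< @set0 T p >] = false by apply/asboolP.
by rewrite !addn0; case: asboolP => // /sAC Cp; rewrite (asboolT Cp).
Qed.

Lemma card_setU1 (T : Type) (x : T) (A : set T) :
  finite_set A -> ~ A x -> card (x |` A) = (card A).+1.
Proof.
move=> fA nAx; rewrite /card (@fset_setU1 {classic T}) // cardfsU1 in_fset_set //.
by rewrite memNset.
Qed.

Lemma card_leq_sub (T : Type) (A C : set T) :
  finite_set C -> A `<=` C -> card C <= card A -> A = C.
Proof.
move=> fC sAC leCA; apply/seteqP; split=> // x Cx; apply: contrapT => nAx.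
have fA := sub_finite_set sAC fC.
have : card (x |` A) <= card C by apply: leq_finite_card => // y [->|/sAC].
by rewrite card_setU1 // ltnNge leCA.
Qed.

Lemma card_preimage (T U : Type) (f : T -> U) (A : set U) :
  bijective f -> card (f @^-1` A) = card A.
Proof.
move=> [g fK gK].
have -> : f @^-1` A = g @` A.
  apply/seteqP; split=> [x Ax|_ [y Ay <-]]; last by rewrite /= gK.
  by exists (f x).
have [fA|nfA] := pselect (finite_set A).
  rewrite /card (@fset_set_image {classic U} {classic T}) //.
  by rewrite card_imfset //=; exact: can_inj gK.
have nfgA : ~ finite_set (g @` A).
  move=> fgA; apply: nfA; apply: sub_finite_set (finite_image f fgA).
  by move=> y Ay; exists (g y) => //; exists y.
rewrite /card /fset_set; case: pselect => // ?; case: pselect => //.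
Qed.

(** * Boundaries and bonds *)

Section Bonds.
Variables (V : Type) (G : sgraph V).
Implicit Types (R S T : set V) (x y : V).

(** Edges are recorded as pairs directed out of [S], so that a pair determines
on which side each of its ends lies. *)
Definition boundary S : set (V * V) :=
  [set p | G p.1 p.2 /\ S p.1 /\ ~ S p.2].

Definition divides S x y : Prop := ~ (S x <-> S y).

Definition connected_graph : Prop := forall x y, clos_refl_trans V G x y.

(** In a connected graph this minimality says that [S] and its complement are
connected; it is the only form in which their connectedness gets used. *)
Definition bond S : Prop :=
  boundary S !=set0 /\
  forall R, (forall x y, G x y -> divides R x y -> divides S x y) ->
    [\/ R = set0, R = setT, R = S | R = ~` S].

Lemma divides_sym S x y : divides S x y -> divides S y x.
Proof. by rewrite /divides => H E; apply: H; split=> /E. Qed.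

Lemma dividesE S x y : divides S x y <-> (S x /\ ~ S y) \/ (~ S x /\ S y).
Proof.
split; last by case=> -[a b] [c d]; [apply/b/c | apply/a/d].
rewrite /divides; have [a|a] := pselect (S x); have [b|b] := pselect (S y).
- by case; split.
- by left.
- by right.
- by case; split.
Qed.

Lemma dividesC S x y : divides (~` S) x y <-> divides S x y.
Proof.
rewrite !dividesE; split=> -[[a b]|[a b]].
- by right; split=> //; apply: contrapT.
- by left; split=> //; apply: contrapT.
- by right; split.
- by left; split.
Qed.

Lemma boundary_divides S x y : boundary S (x, y) -> divides S x y.
Proof. by move=> [_ [/= a b]]; rewrite dividesE; left. Qed.

Lemma divides_of_boundary R S :
  (forall x y, boundary R (x, y) -> divides S x y) ->
  forall x y, G x y -> divides R x y -> divides S x y.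
Proof.
move=> H x y xy /dividesE[[a b]|[a b]]; first exact: H.
by apply: divides_sym; apply: H; split=> //=; exact: adj_sym.
Qed.

Lemma boundary_swap S (p : V * V) : boundary (~` S) p <-> boundary S (p.2, p.1).
Proof.
split=> -[a [/= b c]]; split=> /=; try exact: adj_sym; split=> //.
exact: contrapT.
Qed.

Lemma boundaryC S : boundary (~` S) = (fun p => (p.2, p.1)) @^-1` boundary S.
Proof. by apply/seteqP; split=> p /boundary_swap. Qed.

Lemma swap_bij : bijective (fun p : V * V => (p.2, p.1)).
Proof. by exists (fun p : V * V => (p.2, p.1)) => -[]. Qed.

Lemma finite_boundaryC S : finite_set (boundary S) -> finite_set (boundary (~` S)).
Proof.
move=> fS; rewrite boundaryC; apply: finite_preimage => // p q _ _.
exact: bij_inj swap_bij _ _.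
Qed.

Lemma card_boundaryC S : card (boundary (~` S)) = card (boundary S).
Proof. by rewrite boundaryC card_preimage //; exact: swap_bij. Qed.

Lemma boundary_set0 R : connected_graph -> boundary R = set0 -> R = set0 \/ R = setT.
Proof.
move=> Gc R0; have closed x y : clos_refl_trans V G x y -> R x -> R y.
  elim=> {x y} [x y xy Rx|x //|x y z _ IH1 _ IH2 /IH1 /IH2 //].
  by apply: contrapT => nRy; have : boundary R (x, y) by []; rewrite R0.
have [[x Rx]|R0'] := pselect (R !=set0).
  by right; apply/seteqP; split=> // y _; apply: closed (Gc x y) Rx.
by left; apply/seteqP; split=> // x Rx; case: R0'; exists x.
Qed.

Lemma finite_separating_path (Q : set (set V)) (r : V -> V -> Prop) x y :
  clos_refl_trans V r x y ->
  (forall a b, r a b -> finite_set [set S | [/\ Q S, S a & ~ S b]]) ->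
  finite_set [set S | [/\ Q S, S x & ~ S y]].
Proof.
move=> + H; elim=> {x y} [x y /H //|x|x y z _ IH1 _ IH2].
  by apply: sub_finite_set (finite_set0 _) => S [].
have : finite_set ([set S | [/\ Q S, S x & ~ S y]] `|` [set S | [/\ Q S, S y & ~ S z]]).
  by rewrite finite_setU.
apply: sub_finite_set => S [QS Sx nSz].
by have [Sy|nSy] := pselect (S y); [right|left].
Qed.

(** If [x] and [y] are joined by a path avoiding [D], each bond in [Q] contains
one of the finitely many edges of that path, directed as it is traversed;
otherwise all edges leaving the component of [x] in the graph without [D]
belong to [D], so that this component is the only candidate. *)
Lemma finite_bonds_step (Q : set (set V)) (D : set (V * V)) x y :
  D (x, y) -> (forall S, Q S -> bond S /\ D `<=` boundary S) ->
  (forall a b, ~ D (a, b) -> finite_set [set S | Q S /\ boundary S (a, b)]) ->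
  finite_set Q.
Proof.
move=> Dxy QD fQ; pose r a b := [/\ G a b, ~ D (a, b) & ~ D (b, a)].
have [path|nopath] := pselect (clos_refl_trans V r x y).
  apply: (@sub_finite_set _ _ [set S | [/\ Q S, S x & ~ S y]]).
    by move=> S QS; have [_ DS] := QD _ QS; have [_ [Sx nSy]] := DS _ Dxy.
  apply: finite_separating_path path _ => a b [ab nDab _].
  by apply: sub_finite_set (fQ a b nDab) => S [QS Sa nSb]; split.
apply: (@sub_finite_set _ _ [set clos_refl_trans V r x]) (finite_set1 _) => S QS.
have [[_ bS] DS] := QD _ QS; have [_ [/= Sx nSy]] := DS _ Dxy.
have /bS[K0|KT|->//|KC] : forall a b, G a b ->
    divides (clos_refl_trans V r x) a b -> divides S a b.
- apply: divides_of_boundary => a b [/= ab [Ka nKb]].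
  have [Dab|nDab] := pselect (D (a, b)); first exact/boundary_divides/DS.
  have [Dba|nDba] := pselect (D (b, a)); first exact/divides_sym/boundary_divides/DS.
  by case: nKb; apply: rt_trans Ka (rt_step _ _ _ _ _).
- by have := rt_refl V r x; rewrite K0.
- by case: nopath; rewrite KT.
- by have := rt_refl V r x; rewrite KC => /(_ Sx).
Qed.

(** Induction on the bound [n] for the number of boundary edges missing from [D]. *)
Lemma finite_bonds_extending n (D : set (V * V)) x y :
  D (x, y) -> finite_set D ->
  finite_set [set S | [/\ bond S, finite_set (boundary S), D `<=` boundary S
                        & card (boundary S) <= card D + n]].
Proof.
elim: n D => [|n IH] D Dxy fD; apply: (finite_bonds_step Dxy) => [S []//|a b nDab].
  apply: sub_finite_set (finite_set0 _) => S [[_ fS DS cS] Sab].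
  have : card ((a, b) |` D) <= card (boundary S) by apply: leq_finite_card => // p [->|/DS].
  by rewrite card_setU1 // => /leq_trans/(_ cS); rewrite addn0 ltnn.
apply: sub_finite_set (IH ((a, b) |` D) _ _); last 2 first.
- by right.
- by rewrite finite_setU; split=> //; exact: finite_set1.
move=> S [[bS fS DS cS] Sab]; split=> //; first by move=> p [->|/DS].
by rewrite card_setU1 // addSnnS.
Qed.

Definition bounded_bonds n : set (set V) :=
  [set S | [/\ bond S, finite_set (boundary S) & card (boundary S) <= n]].

Lemma finite_bounded_bonds n x y : connected_graph ->
  finite_set [set S | [/\ bounded_bonds n S, S x & ~ S y]].
Proof.
move=> Gc; apply: finite_separating_path (Gc x y) _ => a b ab.
have := @finite_bonds_extending n [set (a, b)] a b erefl (finite_set1 _).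
apply: sub_finite_set => S [[bS fS cS] Sa nSb]; split=> //; first by move=> _ ->.
exact: leq_trans cS (leq_addl _ _).
Qed.

Definition crosses S T : Prop :=
  [/\ S `&` T !=set0, S `&` ~` T !=set0, ~` S `&` T !=set0 & ~` S `&` ~` T !=set0].

Lemma crosses_sym S T : crosses S T -> crosses T S.
Proof. by move=> [a b c d]; split; rewrite setIC. Qed.

Lemma crossesC S T : crosses S (~` T) = crosses S T.
Proof. by apply/propext; rewrite /crosses setCK; split=> -[a b c d]; split. Qed.

(** If no end of a boundary edge of [S] were in [T], every edge leaving the corner
of [S] and [T] would leave [T], and the bond [T] would not be minimal. *)
Lemma crossing_bond_meets S T : bond T -> crosses S T ->
  exists2 p, boundary S p & T p.1 \/ T p.2.
Proof.
move=> [_ bT] [[a [Sa Ta]] [b [Sb nTb]] [c [nSc Tc]] [d [nSd nTd]]].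
apply: contrapT => H.
have /bT[E|E|E|E] : forall x y, G x y -> divides (S `&` T) x y -> divides T x y.
  apply: divides_of_boundary => x y [/= xy [[Sx Tx] nSTy]].
  have [Ty|nTy] := pselect (T y); last by rewrite dividesE; left.
  by case: H; exists (x, y); [split=> //; split=> // Sy; case: nSTy | left].
- by have : (S `&` T) a by []; rewrite E.
- by have [] : (S `&` T) c by rewrite E.
- by have [] : (S `&` T) c by rewrite E.
- by have : (S `&` T) a by []; rewrite E.
Qed.

Lemma bondC S : bond S -> bond (~` S).
Proof.
move=> [[p Sp] bS]; split.
  by exists (p.2, p.1); rewrite boundaryC; case: p Sp.
move=> R HR; have /bS[->|->|->|->] : forall x y, G x y -> divides R x y -> divides S x y.
  by move=> x y xy /(HR _ _ xy)/dividesC.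
- exact: Or41.
- exact: Or42.
- by apply: Or44; rewrite setCK.
- exact: Or43.
Qed.

(** A bond that crosses [S] separates two vertices of the finite set [W] of ends
of boundary edges of [S]. *)
Lemma finite_crossing_bonds n S : connected_graph -> finite_set (boundary S) ->
  finite_set [set T | bounded_bonds n T /\ crosses S T].
Proof.
move=> Gc fS; pose W := (fst @` boundary S) `|` (snd @` boundary S).
have fW : finite_set W by rewrite finite_setU; split; exact: finite_image.
have fWW := finite_setX fW fW.
have := bigcup_finite fWW (fun p _ => @finite_bounded_bonds n p.1 p.2 Gc).
apply: sub_finite_set => T [bnT cST]; have [bT _ _] := bnT.
have inW R : (exists2 p, boundary S p & R p.1 \/ R p.2) -> exists2 z, W z & R z.
  by move=> [p Sp [Rp|Rp]]; [exists p.1|exists p.2] => //; [left|right]; exists p.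
have [a Wa Ta] := inW _ (crossing_bond_meets bT cST).
have [|b Wb nTb] := inW (~` T) (crossing_bond_meets (bondC bT) _).
  by rewrite crossesC.
by exists (a, b).
Qed.

End Bonds.

(** * Efficient cuts between ends *)

Section EfficientCuts.
Variables (V : Type) (G : sgraph V).
Hypothesis Gc : connected_graph G.
Implicit Types (R S T : set V) (w u : set (set V)).

Local Notation bd := (boundary G).

(** An end is remembered only through the sets of vertices that contain a tail
of its rays: on sets with finite boundary these form an ultrafilter. Vertices
give such ultrafilters too, which does no harm, and the notion is visibly
invariant under automorphisms. *)
Definition cut_ultrafilter w : Prop :=
  [/\ ~ w set0, forall S T, w S -> w T -> w (S `&` T),
      forall S T, S `<=` T -> w S -> w T
    & forall S, finite_set (bd S) -> w S \/ w (~` S)].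

Definition splits w u S : Prop := [/\ finite_set (bd S), w S & u (~` S)].

Definition efficient w u S : Prop :=
  [/\ cut_ultrafilter w, cut_ultrafilter u, splits w u S
    & forall R, splits w u R -> card (bd S) <= card (bd R)].

Definition efficient_cut n S : Prop :=
  exists w u, efficient w u S /\ card (bd S) = n.

Lemma splitsC w u S : splits w u S -> splits u w (~` S).
Proof.
by move=> [fS wS uS]; split; rewrite ?setCK //; exact: finite_boundaryC.
Qed.

Lemma efficientC w u S : efficient w u S -> efficient u w (~` S).
Proof.
move=> [Ew Eu wuS minS]; split=> //; first exact: splitsC.
move=> R /splitsC/minS; by rewrite !card_boundaryC.
Qed.

Lemma efficient_cutC n S : efficient_cut n S -> efficient_cut n (~` S).
Proof.
move=> [w [u [/efficientC e c]]]; exists u, w; split=> //.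
by rewrite card_boundaryC.
Qed.

Lemma finite_boundaryI S T :
  finite_set (bd S) -> finite_set (bd T) -> finite_set (bd (S `&` T)).
Proof.
move=> fS fT; have : finite_set (bd S `|` bd T) by rewrite finite_setU.
apply: sub_finite_set => p [a [/= [Sp Tp] nST]].
have [Sq|nSq] := pselect (S p.2); last by left.
by right; split=> //; split=> // Tq; case: nST.
Qed.

Lemma finite_boundaryU S T :
  finite_set (bd S) -> finite_set (bd T) -> finite_set (bd (S `|` T)).
Proof.
move=> fS fT; rewrite -[S `|` T]setCK setCU; apply: finite_boundaryC.
by apply: finite_boundaryI; exact: finite_boundaryC.
Qed.

Lemma boundary_submodular S T : finite_set (bd S) -> finite_set (bd T) ->
  card (bd (S `&` T)) + card (bd (~` S `&` ~` T)) <= card (bd S) + card (bd T).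
Proof.
move=> fS fT; rewrite -setCU card_boundaryC.
have := @leq_card2 _ (bd (S `&` T)) (bd (S `|` T)) set0 _ _ fS fT.
rewrite card_set0 addn0; apply=> -[x y].
rewrite (_ : `[< set0 (x, y) >] = false) ?addn0; last by apply/asboolP.
have bdE R : `[< bd R (x, y) >] = [&& `[< G x y >], `[< R x >] & ~~ `[< R y >]].
  by rewrite /boundary /= !asbool_and asbool_neg.
rewrite !bdE /= !asbool_and !asbool_or.
by do 5!case: (asbool _).
Qed.

(** The two parts into which [R] divides [S] share out the boundary of [S]. The
part that holds the end takes all of it by minimality, and by connectedness a
part with empty boundary is empty. *)
Lemma efficient_side w u S R : efficient w u S ->
  (forall x y, G x y -> divides R x y -> divides S x y) ->
  S `<=` R \/ S `<=` ~` R.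
Proof.
move=> [Ew Eu [fS wS uS] minS] RS; have [_ wI _ wU] := Ew; have [u0 _ _ _] := Eu.
wlog wR : R RS / w R => [wlogR|].
  have fR : finite_set (bd R).
    have : finite_set (bd S `|` bd (~` S)).
      by rewrite finite_setU; split=> //; exact: finite_boundaryC.
    apply: sub_finite_set => -[x y] Rxy; have [xy _] := Rxy.
    have /dividesE[[a b]|[a b]] := RS _ _ xy (boundary_divides Rxy).
      by left; split.
    by right; split=> //; split=> // nSy; case: nSy.
  have [wR|wR] := wU _ fR; first exact: wlogR.
  have [] // := wlogR (~` R) _ wR; first by move=> x y xy /dividesC; exact: RS.
  - by right.
  - by rewrite setCK; left.
left; have subSR : bd (S `&` R) `<=` bd S.
  move=> [x y] [/= xy [[Sx Rx] nSR]]; split=> //=; split=> // Sy.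
  have /(RS _ _ xy) : divides R x y.
    by rewrite dividesE; left; split=> // Ry; case: nSR.
  by case.
have bdSR : bd (S `&` R) = bd S.
  apply: card_leq_sub => //; apply: minS.
  split; [exact: sub_finite_set subSR fS|exact: wI|].
  by have [_ _ uS' _] := Eu; apply: uS' uS => z nSz [].
have [|E|E] := @boundary_set0 _ _ (S `&` ~` R) Gc.
- apply/seteqP; split=> // -[x y] [/= xy [[Sx nRx] nSR]].
  have [Sy|nSy] := pselect (S y).
    have /(RS _ _ xy) : divides R x y.
      by rewrite dividesE; right; split=> //; apply: contrapT => nRy; case: nSR.
    by case.
  have : bd S (x, y) by [].
  by rewrite -bdSR => -[_ [[]]].
- move=> x Sx; apply: contrapT => nRx; have : (S `&` ~` R) x by [].
  by rewrite E.
- case: u0; rewrite (_ : set0 = ~` S) //; apply/seteqP; split=> // x nSx.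
  by have [/nSx] : (S `&` ~` R) x by rewrite E.
Qed.

Lemma efficient_bond n S : efficient_cut n S -> bond G S.
Proof.
move=> [w [u [eS _]]]; have [[w0 _ _ _] [u0 _ _ _] [fS wS uS] _] := eS; split.
  apply: contrapT => /set0P/negP; rewrite negbK => /eqP bS0.
  have [E|E] := boundary_set0 Gc bS0; first by apply: w0; rewrite -E.
  by apply: u0; rewrite -setCT -E.
move=> R RS; have RS' x y : G x y -> divides R x y -> divides (~` S) x y.
  by move=> xy /(RS _ _ xy) /dividesC.
have [SR|SR] := efficient_side eS RS; have [CR|CR] := efficient_side (efficientC eS) RS'.
- by apply: Or42; apply/seteqP; split=> // x _; have [/SR|/CR] := pselect (S x).
- by apply: Or43; apply/seteqP; split=> // x Rx; apply: contrapT => /CR.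
- by apply: Or44; apply/seteqP; split=> // x Rx /SR.
- by apply: Or41; apply/seteqP; split=> // x Rx; have [/SR|/CR] := pselect (S x).
Qed.

(** Submodularity forces equality when opposite corners separate the two pairs
of ends. *)
Lemma efficient_opposite_corners w w' u u' S T :
  efficient w w' S -> efficient u u' T -> w T -> u' (~` S) ->
  efficient_cut (card (bd S)) (S `&` T) /\
  efficient_cut (card (bd T)) (~` S `&` ~` T).
Proof.
move=> [Ew Ew' [fS wS wS'] minS] [Eu Eu' [fT uT uT'] minT] wT uS'.
have fI := finite_boundaryI fS fT; have fU := finite_boundaryU fS fT.
have sI : splits w w' (S `&` T).
  split=> //; first by case: Ew => _ + _ _; apply.
  by case: Ew' => _ _ m _; apply: m wS' => z nSz [].
have sU : splits u u' (S `|` T).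
  split=> //; first by case: Eu => _ _ m _; apply: m uT; right.
  by rewrite setCU; case: Eu' => _ + _ _; apply.
have leI := minS _ sI; have leU := minT _ sU.
have := boundary_submodular fS fT; rewrite -setCU card_boundaryC => sub.
have cI : card (bd (S `&` T)) = card (bd S).
  apply/eqP; rewrite eqn_leq leI andbT -(leq_add2r (card (bd T))).
  by apply: leq_trans sub; rewrite leq_add2l.
have cU : card (bd (S `|` T)) = card (bd T).
  apply/eqP; rewrite eqn_leq leU andbT -(leq_add2l (card (bd S))).
  by apply: leq_trans sub; rewrite leq_add2r.
split; first by exists w, w'; split=> //; split=> // R /minS; rewrite cI.
by apply: efficient_cutC; exists u, u'; split=> //; split=> // R /minT; rewrite cU.
Qed.

(** The four ends lie in the four corners. Either there are two opposite corners,
one holding an end of the first pair and the other an end of the second, or the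
pairs occupy the two diagonals; in that case submodularity on both diagonals
forces both cuts and all corners to have the same size. *)
Lemma efficient_corners a b S T : efficient_cut a S -> efficient_cut b T ->
  exists S1 T1, [/\ S1 = S \/ S1 = ~` S, T1 = T \/ T1 = ~` T,
    efficient_cut a (S1 `&` T1) & efficient_cut b (~` S1 `&` ~` T1)].
Proof.
move=> [w [w' [eS <-]]] [u [u' [eT <-]]].
have [[_ wI _ wU] [_ w'I _ w'U] [fS wS wS'] minS] := eS.
wlog wT : u u' T eT / w T => [wlogT|].
  have [_ _ [fT _ _] _] := eT; have [wT|wT] := wU _ fT; first exact: wlogT eT wT.
  have [S1 [T1 [HS HT]]] := wlogT _ _ _ (efficientC eT) wT.
  rewrite card_boundaryC => e1 e2; exists S1, T1; split=> //.
  by case: HT => ->; rewrite ?setCK; [right|left].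
have [[_ uI _ uU] [_ u'I _ u'U] [fT uT uT'] minT] := eT.
have [u'S|u'S] := u'U _ fS; last first.
  by have [] := efficient_opposite_corners eS eT wT u'S; exists S, T; split=> //; left.
have [w'T|w'T] := w'U _ fT.
  have [] := efficient_opposite_corners (efficientC eS) eT w'T _; rewrite ?setCK //.
  rewrite card_boundaryC; exists (~` S), T; split; rewrite ?setCK //; [right|left]; by [].
have [uS|uS] := uU _ fS.
  have [] := efficient_opposite_corners (efficientC eS) (efficientC eT) w'T _;
    rewrite ?setCK //.
  rewrite !card_boundaryC => e1 e2.
  by exists (~` S), (~` T); split; rewrite ?setCK //; right.
(* The remaining case of the two diagonals. *)
have [Ew Ew' _ _] := eS; have [Eu Eu' _ _] := eT.
have mono v A B : cut_ultrafilter v -> A `<=` B -> v A -> v B by case=> _ _ + _; apply.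
have sI : splits w w' (S `&` T).
  by split; [exact: finite_boundaryI|exact: wI|apply: mono wS' => // z nSz []].
have sU : splits w w' (S `|` T).
  split; [exact: finite_boundaryU|apply: mono wS => // z; by left|].
  by rewrite setCU; exact: w'I.
have tI : splits u u' (~` S `&` T).
  split; [|exact: uI|by apply: mono u'S => // z Sz []].
  by apply: finite_boundaryI => //; exact: finite_boundaryC.
have tU : splits u u' (~` S `|` T).
  split; [|by apply: mono uT => // z; right|].
    by apply: finite_boundaryU => //; exact: finite_boundaryC.
  by rewrite setCU setCK; exact: u'I.
have l1 := minS _ sI; have l2 := minS _ sU; have l3 := minT _ tI; have l4 := minT _ tU.
have := boundary_submodular fS fT; rewrite -setCU card_boundaryC => sub1.
have := boundary_submodular (finite_boundaryC fS) fT.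
rewrite -setCU !card_boundaryC => sub2.
have leTS : card (bd T) <= card (bd S).
  by rewrite -(leq_add2r (card (bd T))) (leq_trans _ sub2) // leq_add.
have leST : card (bd S) <= card (bd T).
  by rewrite -(leq_add2l (card (bd S))) (leq_trans _ sub1) // leq_add.
have eST : card (bd T) = card (bd S) by apply/eqP; rewrite eqn_leq leTS.
rewrite eST in sub1 *.
have cI : card (bd (S `&` T)) = card (bd S).
  apply/eqP; rewrite eqn_leq l1 andbT -(leq_add2r (card (bd S))).
  by apply: leq_trans sub1; rewrite leq_add2l.
have cU : card (bd (S `|` T)) = card (bd S).
  apply/eqP; rewrite eqn_leq l2 andbT -(leq_add2l (card (bd S))).
  by apply: leq_trans sub1; rewrite leq_add2r.
exists S, T; split; [by left|by left| |].
  by exists w, w'; split=> //; split=> // R /minS; rewrite cI.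
rewrite -setCU; apply: efficient_cutC.
by exists w, w'; split=> //; split=> // R /minS; rewrite cU.
Qed.

End EfficientCuts.

(** * Nested families of efficient cuts *)

Section OptimalCuts.
Variables (V : Type) (G : sgraph V).
Hypothesis Gc : connected_graph G.
Implicit Types (R S T : set V).

Local Notation bd := (boundary G).

Definition small_cut M R : Prop := exists2 n, n <= M & efficient_cut G n R.

Definition crossing_number M S : nat :=
  card [set R | small_cut M R /\ crosses S R].

(** Cuts of all sizes up to [M] are counted in the crossing numbers, so that
optimal cuts of different sizes are nested as well. *)
Definition optimal_cut M S : Prop :=
  exists2 n, n <= M & efficient_cut G n S /\
    forall R, efficient_cut G n R -> crossing_number M S <= crossing_number M R.

Lemma efficient_cut_card n S : efficient_cut G n S -> card (bd S) = n.
Proof. by move=> [w [u []]]. Qed.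

Lemma efficient_cut_finite n S : efficient_cut G n S -> finite_set (bd S).
Proof. by move=> [w [u [[_ _ []]]]]. Qed.

Lemma finite_crossing M n S : efficient_cut G n S ->
  finite_set [set R | small_cut M R /\ crosses S R].
Proof.
move=> /efficient_cut_finite fS; apply: sub_finite_set (finite_crossing_bonds M Gc fS).
move=> R [[m mM eR] cSR]; split=> //; split; first exact: efficient_bond Gc _ _ eR.
  exact: efficient_cut_finite eR.
by rewrite (efficient_cut_card eR).
Qed.

Lemma crossesCl S T : crosses (~` S) T = crosses S T.
Proof.
by apply/propext; split=> /crosses_sym c; apply: crosses_sym;
  move: c; rewrite crossesC.
Qed.

(** If [R] were nested with both cuts, the complements of [S] and of [T] would
each lie on one side of [R], on the same side because they meet; but [R] divides
their union. *)
Lemma crosses_corner S T R : crosses S T -> crosses (S `&` T) R ->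
  crosses S R \/ crosses T R.
Proof.
move=> [_ _ _ [z [nSz nTz]]].
move=> [[a [[Sa Ta] Ra]] [b [[Sb Tb] nRb]] [c [nc Rc]] [d [nd nRd]]].
have side A : A a -> A b -> ~ crosses A R ->
    (forall x, ~ A x -> R x) \/ (forall x, ~ A x -> ~ R x).
  move=> Aa Ab nAR; apply: contrapT => nH; apply: nAR.
  split; [by exists a|by exists b| |].
    by apply: contrapT => E; apply: nH; right=> x nAx Rx; apply: E; exists x.
  apply: contrapT => E; apply: nH; left=> x nAx; apply: contrapT => nRx.
  by apply: E; exists x.
apply: contrapT => /not_orP[/(side _ Sa Sb) nS /(side _ Ta Tb) nT].
have outside x : ~ (S `&` T) x -> ~ S x \/ ~ T x by move/not_andP.
case: nS nT => [nS|nS] [nT|nT].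
- by case: (outside _ nd) => [/nS|/nT].
- by case: (nT _ nTz); exact: nS.
- by case: (nS _ nSz); exact: nT.
- by case: (outside _ nc) => [/nS|/nT].
Qed.

Lemma crosses_both_corners S T R :
  crosses (S `&` T) R -> crosses (~` S `&` ~` T) R -> crosses S R /\ crosses T R.
Proof.
move=> [[a [[Sa Ta] Ra]] [b [[Sb Tb] nRb]] _ _].
move=> [[c [[Sc Tc] Rc]] [d [[Sd Td] nRd]] _ _].
by split; split; [exists a|exists b|exists c|exists d
                 |exists a|exists b|exists c|exists d].
Qed.

(** Each cut crosses at most as many of the two corners as of [S] and [T], and [T]
itself, which crosses [S], crosses neither corner. *)
Lemma crossing_number_corners M m n S T :
  efficient_cut G m S -> efficient_cut G n T -> n <= M -> crosses S T ->
  crossing_number M (S `&` T) + crossing_number M (~` S `&` ~` T)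
    < crossing_number M S + crossing_number M T.
Proof.
move=> eS eT nM cST; rewrite -addn1 -(card_set1 T); apply: leq_card2.
- exact: finite_crossing eS.
- exact: finite_crossing eT.
move=> R; have [sR|nsR] := pselect (small_cut M R); last first.
  have F (P : Prop) : `[< small_cut M R /\ P >] = false by apply/asboolP => -[].
  rewrite /= !F (_ : `[< _ = _ >] = false) //; apply/asboolP => RT.
  by apply: nsR; rewrite RT; exists n.
have E (P : Prop) : `[< small_cut M R /\ P >] = `[< P >] by rewrite asbool_and asboolT.
rewrite /= !E; have [->|nRT] := pselect (R = T).
  have F1 : `[< crosses (S `&` T) T >] = false.
    by apply/asboolP => -[_ [x [[_ Tx] nTx]] _ _].
  have F2 : `[< crosses (~` S `&` ~` T) T >] = false.
    by apply/asboolP => -[[x [[_ nTx] Tx]] _ _ _].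
  by rewrite F1 F2 (asboolT cST) asboolT // leq_addr.
have c1 := @crosses_corner S T R cST.
have c2 : crosses (~` S `&` ~` T) R -> crosses S R \/ crosses T R.
  have := @crosses_corner (~` S) (~` T) R; rewrite !crossesCl crossesC.
  by move=> H; exact: H.
have c12 := @crosses_both_corners S T R.
have -> : `[< R = T >] = false by apply/asboolP.
rewrite addn0.
case: (asboolP (crosses (S `&` T) R)) => x1;
  case: (asboolP (crosses (~` S `&` ~` T) R)) => x2 //.
- by have [y1 y2] := c12 x1 x2; rewrite !asboolT.
- by case: (c1 x1) => y; rewrite (asboolT y) ?leq_addl // leq_addr.
- by case: (c2 x2) => y; rewrite (asboolT y) ?leq_addl // leq_addr.
Qed.

(** Two crossing optimal cuts could be replaced by opposite corners of the same
two sizes with a smaller total crossing number. *)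
Lemma optimal_cuts_nested M S T :
  optimal_cut M S -> optimal_cut M T -> ~ crosses S T.
Proof.
move=> [m mM [eS oS]] [n nM [eT oT]] cST.
have [S1 [T1 [HS HT e1 e2]]] := efficient_corners eS eT.
have eS1 : efficient_cut G m S1 by case: HS => -> //; exact: efficient_cutC.
have eT1 : efficient_cut G n T1 by case: HT => -> //; exact: efficient_cutC.
have CC R : crossing_number M (~` R) = crossing_number M R.
  by congr card; apply/seteqP; split=> Q /=; rewrite crossesCl.
have c1 : crosses S1 T1.
  by case: HS HT => -> [] ->; rewrite ?crossesC ?crossesCl.
have := crossing_number_corners eS1 eT1 nM c1.
have -> : crossing_number M S1 = crossing_number M S by case: HS => ->.
have -> : crossing_number M T1 = crossing_number M T by case: HT => ->.
by rewrite ltnNge leq_add // ?oS ?oT.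
Qed.

Lemma optimal_cut_exists M n S : efficient_cut G n S -> n <= M ->
  exists2 R, optimal_cut M R & efficient_cut G n R.
Proof.
move=> eS nM; pose P m := `[< exists2 R, efficient_cut G n R & crossing_number M R = m >].
have exP : exists m, P m by exists (crossing_number M S); apply/asboolP; exists S.
case: (ex_minnP exP) => m /asboolP[R eR <-] minR.
exists R => //; exists n => //; split=> // T eT.
by apply: minR; apply/asboolP; exists T.
Qed.

(** ** Invariance under automorphisms *)

Section Automorphism.
Variables (f g : V -> V).
Hypotheses (fK : cancel f g) (gK : cancel g f).
Hypothesis fG : forall x y, G (f x) (f y) <-> G x y.

Lemma boundary_preimage S :
  bd (f @^-1` S) = (fun p => (f p.1, f p.2)) @^-1` bd S.
Proof. by apply/seteqP; split=> p [/= /fG]. Qed.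

Lemma pair_map_bij : bijective (fun p : V * V => (f p.1, f p.2)).
Proof. by exists (fun p => (g p.1, g p.2)) => -[x y] /=; rewrite ?fK ?gK. Qed.

Lemma card_boundary_preimage S : card (bd (f @^-1` S)) = card (bd S).
Proof. by rewrite boundary_preimage card_preimage //; exact: pair_map_bij. Qed.

Lemma finite_boundary_preimage S : finite_set (bd S) -> finite_set (bd (f @^-1` S)).
Proof.
move=> fS; rewrite boundary_preimage; apply: finite_preimage => // p q _ _.
exact: bij_inj pair_map_bij _ _.
Qed.

Lemma cut_ultrafilter_preimage w :
  cut_ultrafilter G w -> cut_ultrafilter G [set S | w (f @^-1` S)].
Proof.
move=> [w0 wI wM wU]; split=> //=; first by move=> S T; exact: wI.
  by move=> S T ST; apply: wM => x; exact: ST.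
by move=> S /finite_boundary_preimage /wU.
Qed.

Lemma crosses_preimage S T : crosses (f @^-1` S) (f @^-1` T) <-> crosses S T.
Proof.
have ne A : (f @^-1` A !=set0) = (A !=set0).
  apply/propext; split=> -[x Ax]; first by exists (f x).
  by exists (g x); rewrite /= gK.
rewrite -[crosses (_ @^-1` _) _]/([/\ f @^-1` (S `&` T) !=set0,
  f @^-1` (S `&` ~` T) !=set0, f @^-1` (~` S `&` T) !=set0
  & f @^-1` (~` S `&` ~` T) !=set0]).
by rewrite !ne.
Qed.

End Automorphism.

Lemma efficient_cut_preimage f g n S : cancel f g -> cancel g f ->
  (forall x y, G (f x) (f y) <-> G x y) ->
  efficient_cut G n S -> efficient_cut G n (f @^-1` S).
Proof.
move=> fK gK fG [w [u [[Ew Eu [fS wS uS] minS] <-]]].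
have gG x y : G (g x) (g y) <-> G x y by rewrite -fG !gK.
have gfE (R : set V) : g @^-1` (f @^-1` R) = R.
  by apply/seteqP; split=> x /=; rewrite gK.
exists [set R | w (g @^-1` R)], [set R | u (g @^-1` R)].
split; last exact: card_boundary_preimage fK gK fG _.
split; try exact: (cut_ultrafilter_preimage gK fK gG).
  split; rewrite /= ?gfE //; first exact: (finite_boundary_preimage fK gK fG).
  by rewrite -[~` _]/(f @^-1` (~` S)) gfE.
move=> R [fR wR uR]; rewrite (card_boundary_preimage fK gK fG).
rewrite -(card_boundary_preimage gK fK gG R); apply: minS; split=> //.
exact: (finite_boundary_preimage gK fK gG).
Qed.

Lemma optimal_cut_preimage M f g S : cancel f g -> cancel g f ->
  (forall x y, G (f x) (f y) <-> G x y) ->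
  optimal_cut M S -> optimal_cut M (f @^-1` S).
Proof.
move=> fK gK fG [n nM [eS oS]]; exists n => //; split.
  exact: efficient_cut_preimage gK fG eS.
move=> R /oS; congr (_ <= _).
have gG x y : G (g x) (g y) <-> G x y by rewrite -fG !gK.
have gfE (Q : set V) : g @^-1` (f @^-1` Q) = Q.
  by apply/seteqP; split=> x /=; rewrite gK.
have fgE (Q : set V) : f @^-1` (g @^-1` Q) = Q.
  by apply/seteqP; split=> x /=; rewrite fK.
symmetry; rewrite /crossing_number.
rewrite -(@card_preimage _ _ (fun Q : set V => f @^-1` Q)
  [set R | _ /\ crosses (_ @^-1` _) R]).
  congr card; apply/seteqP; split=> Q [[m mM eQ] cQ].
    split; last exact: (crosses_preimage gK S Q).1 cQ.
    exists m => //; rewrite -(gfE Q); exact: efficient_cut_preimage fK gG eQ.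
  split; last exact: (crosses_preimage gK S Q).2 cQ.
  exists m => //; exact: efficient_cut_preimage gK fG eQ.
by exists (fun Q => g @^-1` Q).
Qed.

End OptimalCuts.

(** * Bounding the number of sizes of efficient cuts *)

Section Locality.
Variables (V : Type) (G : sgraph V).

Fixpoint ball (k : nat) (v : V) : set V :=
  if k is k'.+1 then ball k' v `|` [set z | exists2 y, ball k' v y & G y z]
  else [set v].

(** A symmetric relation [A] on edges is a 1-cochain over the field with two
elements, and cuts are coboundaries: the property is the vanishing of the first
cohomology of the complex obtained from [G] by coning off its balls of radius
[k]. *)
Definition cuts_are_local (k : nat) : Prop :=
  forall A : V -> V -> Prop, (forall x y, A x y -> A y x) ->
    (forall v, exists R, forall x y,
       ball k v x -> ball k v y -> G x y -> (A x y <-> divides R x y)) ->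
    exists R, forall x y, G x y -> (A x y <-> divides R x y).

Lemma ball_center k v : ball k v v.
Proof. by elim: k => //= k IH; left. Qed.

Lemma ball_finite k v : locally_finite G -> finite_set (ball k v).
Proof.
move=> Gf; elim: k => [|k IH] /=; first exact: finite_set1.
rewrite finite_setU; split=> //.
apply: sub_finite_set (bigcup_finite IH (fun y _ => Gf y)) => z [y ky yz].
by exists y.
Qed.

Lemma ball_adj k v x : G v x -> ball k.+1 v x.
Proof. by move=> vx; right; exists v => //; exact: ball_center. Qed.

Lemma ball_mono k v x : ball k v x -> ball k.+1 v x.
Proof. by left. Qed.

Lemma ball_map f k v x : (forall x y, G (f x) (f y) <-> G x y) ->
  ball k v x -> ball k (f v) (f x).
Proof.
move=> fG; elim: k x => [x ->//|k IH x [/IH|[y /IH fy yx]]]; first by left.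
by right; exists (f y) => //; apply/fG.
Qed.

End Locality.

Lemma finite_chain_max (V : Type) (F : set (set V)) : finite_set F ->
  (forall P Q, F P -> F Q -> P `<=` Q \/ Q `<=` P) ->
  F = set0 \/ exists2 P, F P & forall Q, F Q -> Q `<=` P.
Proof.
move=> /(@finite_seqP {classic (set V)})[s ->].
elim: s => [|P s IH] chain; first by left; rewrite set_nil.
have sP (Q : {classic (set V)}) : Q \in s -> Q \in P :: s by rewrite inE orbC => ->.
have PP : P \in P :: s by rewrite inE eqxx.
right; case: IH => [Q R Qs Rs|s0|[Q Qs maxQ]]; first by apply: chain; exact: sP.
  exists P => //= Q; rewrite inE => /orP[/eqP->//|Qs].
  by have : [set` s] Q by []; rewrite s0.
have [PQ|QP] := chain P Q PP (sP _ Qs).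
  exists Q => [|R]; rewrite /= inE ?[Q \in s]Qs ?orbT //.
  by case/orP=> [/eqP->|/maxQ].
exists P => //= R; rewrite inE => /orP[/eqP->//|/maxQ RQ].
exact: subset_trans RQ QP.
Qed.

Section GapCounting.
Variables (V : Type) (G : sgraph V).
Hypothesis Gc : connected_graph G.
Hypothesis Gtrans : transitive_graph G.
Variables (k M : nat).
Hypothesis Gloc : cuts_are_local G k.
Implicit Types (R S T Q : set V) (p q : V * V).

Local Notation bd := (boundary G).
Local Notation opt := (optimal_cut G M).

(** [P] is to be the predecessor of [S] among the optimal cuts through [p]. It need
not be such a cut itself, which lets the empty set take this role when [S] comes
first. *)
Definition gap P S p : Prop :=
  [/\ opt S, bd S p, P `<=` S
    & forall Q, opt Q -> bd Q p -> Q `<=` S -> Q <> S -> Q `<=` P].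

(** Nested cuts through [p] are comparable, since two of the four corners contain
an end of [p]. *)
Lemma optimal_chain S T p : opt S -> opt T -> bd S p -> bd T p ->
  S `<=` T \/ T `<=` S.
Proof.
move=> oS oT [_ [S1 nS2]] [_ [T1 nT2]]; apply: contrapT => /not_orP[nST nTS].
apply: (optimal_cuts_nested Gc oS oT); split.
- by exists p.1.
- by apply: contrapT => E; apply: nST => x Sx; apply: contrapT => nTx; apply: E; exists x.
- by apply: contrapT => E; apply: nTS => x Tx; apply: contrapT => nSx; apply: E; exists x.
- by exists p.2.
Qed.

Lemma optimal_bond S : opt S -> bond G S.
Proof. by move=> [n _ [eS _]]; exact: efficient_bond Gc _ _ eS. Qed.

Lemma finite_optimal_at p : finite_set [set S | opt S /\ bd S p].
Proof.
apply: sub_finite_set (finite_bounded_bonds M p.1 p.2 Gc) => S.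
move=> [[n nM [eS _]] [_ [S1 S2]]].
split=> //; split; first exact: efficient_bond Gc _ _ eS.
  exact: efficient_cut_finite eS.
by rewrite (efficient_cut_card eS).
Qed.

Lemma gap_exists S p : opt S -> bd S p ->
  exists2 P, gap P S p & P = set0 \/ [/\ opt P, bd P p & P <> S].
Proof.
move=> oS Sp; pose F := [set Q | [/\ opt Q, bd Q p, Q `<=` S & Q <> S]].
have fF : finite_set F.
  by apply: sub_finite_set (finite_optimal_at p) => Q [].
have [Q T [oQ Qp _ _] [oT Tp _ _]|F0|[P [oP Pp PS nPS] maxP]] := finite_chain_max fF.
- exact: optimal_chain Qp Tp.
- exists set0; last by left.
  split=> // Q oQ Qp QS nQS; have : F Q by [].
  by rewrite F0.
- by exists P; [split=> // Q oQ Qp QS nQS; exact: maxP | right].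
Qed.

(** A cut between [P] and [S] contains every edge that the two have in common, so
the same cuts separate them at each of these edges. *)
Lemma gap_transport P S p q : opt P -> gap P S p -> bd P p -> bd S q -> bd P q ->
  gap P S q.
Proof.
move=> oP [oS Sp PS maxP] Pp Sq Pq; split=> // Q oQ Qq QS nQS.
have [//|PQ] := optimal_chain oQ oP Qq Pq.
apply: maxP => //; case: Pp Sp => [pp [P1 _]] [_ [_ nS2]].
by split=> //; split; [exact: PQ | move/QS].
Qed.

(** Unless [P] is empty, it and [S] are distinct bonds with a common edge, so the
set of their common edges is not a cut and fails to be one in some ball. In that
ball there is a common edge, as otherwise the empty set would do, and [P] and [S]
differ there, as otherwise [S] itself would do. The radius [k.+1] is for the
case of empty [P], where the ball has to contain an edge. *)
Lemma marked_gap_somewhere S : opt S -> exists v P p z,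
  [/\ gap P S p, ball G k.+1 v p.1, ball G k.+1 v p.2, ball G k.+1 v z & S z /\ ~ P z].
Proof.
move=> oS; have [p Sp] := (optimal_bond oS).1.
have [P gPS [P0|[oP Pp nPS]]] := gap_exists oS Sp.
  have [pp [S1 _]] := Sp; exists p.1, P, p, p.1; split=> //; try exact: ball_center.
    exact: ball_adj.
  by rewrite P0; split.
have [_ _ PS _] := gPS.
apply: contrapT => unmarked.
pose A x y := divides S x y /\ divides P x y.
have [|v|R RA] := Gloc (A := A).
- by move=> x y [dS dP]; split; exact: divides_sym.
- have [[x [y [vx [vy [xy [dS dP]]]]]]|nA] := pselect (exists x y,
    ball G k v x /\ ball G k v y /\ G x y /\ A x y); last first.
    exists set0 => x y vx vy xy; split=> [Axy|]; first by case: nA; exists x, y.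
    by rewrite /divides => -[].
  wlog Px : x y vx vy xy dS dP / P x => [wlogP|].
    have /dividesE[[Px _]|[_ Py]] := dP; first exact: (wlogP x y).
    apply: (wlogP y x) => //; [exact: adj_sym|exact: divides_sym|exact: divides_sym].
  have nPy : ~ P y by case/dividesE: dP => -[].
  have Sx := PS _ Px.
  have nSy : ~ S y by case/dividesE: dS => -[].
  have gxy : gap P S (x, y) by apply: gap_transport gPS Pp _ _.
  exists S => a b va vb ab; split=> [[]//|dSab]; split=> //.
  have agree z : ball G k v z -> (S z <-> P z).
    move=> vz; split=> [Sz|/PS //]; apply: contrapT => nPz; apply: unmarked.
    by exists v, P, (x, y), z; split=> //; exact: ball_mono.
  by move: dSab; rewrite /divides !agree.
- have RS x y : G x y -> divides R x y -> divides S x y by move=> xy /(RA _ _ xy)[].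
  have [pp [/= S1 nS2]] := Sp; have [_ [/= P1 nP2]] := Pp.
  have Rp : divides R p.1 p.2 by apply/(RA _ _ pp); split; apply/dividesE; left.
  have RSE x y : divides R x y <-> divides S x y.
    have [E|E|E|E] := (optimal_bond oS).2 R RS; rewrite E ?dividesC //.
      by move: Rp; rewrite E => -[].
    by move: Rp; rewrite E => -[].
  have SP x y : G x y -> divides S x y -> divides P x y.
    by move=> xy /RSE/(RA _ _ xy)[].
  have [E|E|E|E] := (optimal_bond oP).2 S SP.
  - by rewrite E in S1.
  - by apply: nS2; rewrite E.
  - exact: nPS.
  - by rewrite E in S1.
Qed.

Lemma gap_preimage f g P S p : cancel f g -> cancel g f ->
  (forall x y, G (f x) (f y) <-> G x y) ->
  gap P S p -> gap (g @^-1` P) (g @^-1` S) (f p.1, f p.2).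
Proof.
move=> fK gK fG [oS [pp [S1 nS2]] PS maxP].
have gG x y : G (g x) (g y) <-> G x y by rewrite -fG !gK.
split.
- exact: optimal_cut_preimage gK fK gG oS.
- by split=> /=; [apply/fG | rewrite !fK].
- by move=> x; exact: PS.
move=> Q oQ [/= /fG qq [Q1 nQ2]] QS nQS z Qz.
apply: (maxP (f @^-1` Q)); rewrite /= ?gK //.
- exact: optimal_cut_preimage fK gK fG oQ.
- by move=> x /QS; rewrite /= fK.
- move=> E; apply: nQS; apply/seteqP; split=> // x.
  by rewrite -E /= gK.
Qed.

Lemma marked_gap S v : opt S -> exists P T p z,
  card (bd T) = card (bd S) /\
  [/\ gap P T p, ball G k.+1 v p.1, ball G k.+1 v p.2, ball G k.+1 v z & T z /\ ~ P z].
Proof.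
move=> /marked_gap_somewhere[v' [P [p [z [gPS b1 b2 bz [Sz nPz]]]]]].
have [f [[[g fK gK] fG] fv]] := Gtrans v' v.
exists (g @^-1` P), (g @^-1` S), (f p.1, f p.2), (f z); split.
  have gG x y : G (g x) (g y) <-> G x y by rewrite -fG !gK.
  exact: card_boundary_preimage gK fK gG _.
rewrite -fv; split; try exact: ball_map.
  exact: gap_preimage.
by rewrite /= fK.
Qed.

(** As the traces agree, [S] and [S'] both contain the edges [p] and [p'], so they
are comparable. If [S] were smaller, it would lie in [P'], whose trace is that
of [P]; but [S] has a vertex in [B] outside [P]. *)
Lemma gap_trace_inj (B : set V) P S p z P' S' p' z' :
  gap P S p -> gap P' S' p' ->
  B p.1 -> B p.2 -> B p'.1 -> B p'.2 -> B z -> S z -> ~ P z -> B z' -> S' z' -> ~ P' z' ->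
  (forall x, B x -> (S x <-> S' x)) -> (forall x, B x -> (P x <-> P' x)) ->
  S = S'.
Proof.
move=> [oS Sp PS maxP] [oS' Sp' PS' maxP'] Bp1 Bp2 Bp1' Bp2' Bz Sz nPz Bz' Sz' nPz' eS eP.
have S'p : bd S' p.
  by case: Sp => [pp [a b]]; split=> //; split; [apply/eS|move/eS => /(_ Bp2)].
have Sp'' : bd S p'.
  by case: Sp' => [pp [a b]]; split=> //; split; [apply/eS|move/eS => /(_ Bp2')].
apply: contrapT => nSS'.
have [SS'|S'S] := optimal_chain oS oS' Sp S'p.
  by have /(_ _ Sz)/eP := maxP' _ oS Sp'' SS' nSS'; move=> /(_ Bz).
by have /(_ _ Sz')/eP := maxP _ oS' S'p S'S (nesym nSS'); move=> /(_ Bz').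
Qed.

End GapCounting.

Section BoundedCuts.
Variables (V : Type) (G : sgraph V).
Hypotheses (Gc : connected_graph G) (Gfin : locally_finite G).
Hypothesis Gtrans : transitive_graph G.
Variable (k : nat).
Hypothesis Gloc : cuts_are_local G k.

Local Notation bd := (boundary G).

Definition trace (s : seq V) (S : set V) : {ffun 'I_(size s) -> bool} :=
  [ffun i => `[< S (tnth (in_tuple s) i) >]].

Lemma trace_eq (s : seq {classic V}) (S T : set V) x :
  trace s S = trace s T -> x \in s -> (S x <-> T x).
Proof.
move=> e /(tnthP (in_tuple s))[i ->]; have /ffunP/(_ i) := e.
by rewrite !ffunE => E; split=> /asboolP; [rewrite E|rewrite -E]; move/asboolP.
Qed.

(** Otherwise there are efficient cuts of more sizes than there are pairs of traces
on the ball around [v], and a level [M] above all these sizes; but two marked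
gaps with equal traces have larger cuts of equal size. *)
Theorem bounded_splitting (v : V) : exists K, forall w u,
  cut_ultrafilter G w -> cut_ultrafilter G u -> (exists S, splits G w u S) ->
  exists2 S, splits G w u S & card (bd S) <= K.
Proof.
have [s sE] := (@finite_seqP {classic V} _).1 (ball_finite k.+1 v Gfin).
apply: contrapT => unbounded.
have large K : exists S, exists2 n, efficient_cut G n S & K < n.
  apply: contrapT => H; apply: unbounded; exists K => w u Ew Eu [S0 S0wu].
  pose P n := `[< exists2 S, splits G w u S & card (bd S) = n >].
  have exP : exists n, P n by exists (card (bd S0)); apply/asboolP; exists S0.
  case: (ex_minnP exP) => n /asboolP[S Swu Sn] minS; exists S => //.
  rewrite leqNgt; apply/negP => KS; apply: H; exists S, (card (bd S)) => //.
  exists w, u; split=> //; split=> // R Rwu; rewrite Sn.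
  by apply: minS; apply/asboolP; exists R.
have [next nextP] : {next : nat -> nat &
    forall K, (exists S, efficient_cut G (next K) S) /\ K < next K}.
  apply: (@choice _ _ (fun K n => (exists S, efficient_cut G n S) /\ K < n)) => K.
  by have [S [n eS Kn]] := large K; exists n; split=> //; exists S.
pose sz i := iter i next (next 0).
have szP i : exists S, efficient_cut G (sz i) S.
  by case: i => [|i] /=; apply: (nextP _).1.
have sz_lt : {homo sz : i j / i < j}.
  by apply: homo_ltn => [y x z|i]; [exact: ltn_trans | exact: (nextP _).2].
pose traces := ({ffun 'I_(size s) -> bool} * {ffun 'I_(size s) -> bool})%type.
pose N := #|{: traces}|; pose M := sz N.
pose marked (i : 'I_N.+1) (d : set V * set V * (V * V) * V) : Prop :=
  let: (P, T, p, z) := d in card (bd T) = sz i /\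
    [/\ gap G M P T p, ball G k.+1 v p.1, ball G k.+1 v p.2, ball G k.+1 v z
      & T z /\ ~ P z].
have [d dP] : {d & forall i, marked i (d i)}.
  apply: choice => i.
  have [S eS] := szP i.
  have szM : sz i <= M.
    by have := ltn_ord i; rewrite ltnS leq_eqVlt => /orP[/eqP->//|/sz_lt/ltnW].
  have [R oR eR] := optimal_cut_exists eS szM.
  have [P [T [p [z [cT gT]]]]] := marked_gap Gc Gtrans Gloc v oR.
  by exists (P, T, p, z); rewrite /marked cT (efficient_cut_card eR).
pose F i : traces := (trace s (d i).1.1.1, trace s (d i).1.1.2).
have /injectivePn[i [j ij Fij]] : ~~ injectiveb F.
  by apply/injectiveP => /leq_card; rewrite card_ord ltnn.
have sz_ij : sz i = sz j.
  move: (dP i) (dP j) Fij; rewrite /F; case: (d i) => [[[P T] p] z].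
  case: (d j) => [[[P' T'] p'] z'] /= [<- [g b1 b2 bz [Tz nPz]]].
  move=> [<- [g' b1' b2' bz' [Tz' nPz']]].
  move=> -[eP eT]; congr (card (bd _)).
  have inS x : ball G k.+1 v x -> (x : {classic V}) \in s by rewrite sE.
  apply: (gap_trace_inj (B := ball G k.+1 v) Gc g g' b1 b2 b1' b2'
    bz Tz nPz bz' Tz' nPz') => x /inS xs.
    exact: trace_eq eT xs.
  exact: trace_eq eP xs.
have : val i = val j by case: (ltngtP i j) => // /sz_lt; rewrite sz_ij ltnn.
by move/val_inj/eqP; apply/negP.
Qed.

End BoundedCuts.

(** * Cuts are local when short cycles generate the cycle space *)

Section CycleParity.
Import GRing.Theory.
Local Open Scope ring_scope.
Variables (V : Type) (G : sgraph V) (A : V -> V -> Prop).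
Hypothesis Asym : forall x y, A x y -> A y x.

Definition weight x y : 'F_2 := (`[< A x y >])%:R.

Lemma F2_addxx (x : 'F_2) : x + x = 0.
Proof. by apply/val_inj; case: x => -[|[|]]. Qed.

Lemma F2_flip (x : 'F_2) : ~ (x = 1 <-> x + 1 = 1).
Proof.
have [->|->] : x = 0 \/ x = 1.
  by case: x => -[|[|//]] ?; [left|right]; exact: val_inj.
  by rewrite add0r => -[_ /(_ erefl)/eqP]; rewrite eq_sym oner_eq0.
by rewrite F2_addxx => -[/(_ erefl)/eqP]; rewrite eq_sym oner_eq0.
Qed.

Lemma weight_sym x y : weight x y = weight y x.
Proof.
by congr (_ %:R); congr nat_of_bool; apply/asbool_equiv_eq; split; exact: Asym.
Qed.

Lemma edge_eq (x y a b : V) : [set x; y] = [set a; b] ->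
  (x = a /\ y = b) \/ (x = b /\ y = a).
Proof.
move=> E; have : [set a; b] x by rewrite -E; left.
have : [set a; b] y by rewrite -E; right.
have : [set x; y] a by rewrite E; left.
have : [set x; y] b by rewrite E; right.
rewrite /=; intuition congruence.
Qed.

Lemma modn_succ2_neq m j : (2 < m)%N -> (j < m)%N -> ((j.+1 %% m).+1 %% m)%N <> j.
Proof.
move=> m3; rewrite leq_eqVlt => /orP[/eqP E|jm].
  by rewrite E modnn modn_small ?(ltnW m3) // => E1; rewrite -E -E1 in m3.
rewrite (modn_small jm); move: jm; rewrite leq_eqVlt => /orP[/eqP E|jm].
  by rewrite E modnn => E0; rewrite -E -E0 in m3.
by rewrite modn_small // => /eqP; rewrite gtn_eqF.
Qed.

Lemma cycle_edge_inj n (c : 'I_n -> V) : (3 <= n)%N -> injective c ->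
  injective (fun i => [set c i; c (ordS i)]).
Proof.
move=> n3 cI i j /edge_eq[[/cI//]|[/cI ij /cI ji]].
have /(congr1 val) /= : ordS (ordS j) = j by rewrite -ij.
by case/(modn_succ2_neq n3 (ltn_ord j)).
Qed.

(** The parity of the number of edges of [A] on a cycle depends linearly on the
edge vector of the cycle. Vectors may have infinite support, so the sum runs over
a finite list [L] of edges, to contain all cycles under consideration. *)
Definition edge_functional (L : seq {classic (set V)}) (v : set V -> ('F_2)^o) : 'F_2 :=
  \sum_(e <- L) (`[< exists x y, e = [set x; y] /\ A x y >])%:R * v e.

Lemma edge_functional_cycle (L : seq {classic (set V)}) n (c : 'I_n -> V) :
  (3 <= n)%N -> injective c -> uniq L ->
  [set [set c i; c (ordS i)] | i in [set: 'I_n]] `<=` [set` L] ->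
  edge_functional L (edge_vec [set [set c i; c (ordS i)] | i in [set: 'I_n]])
    = \sum_(i < n) weight (c i) (c (ordS i)).
Proof.
move=> n3 cI uL CL; set C := [set _ | _ in _] in CL *.
pose edge (i : 'I_n) : {classic (set V)} := [set c i; c (ordS i)].
transitivity (\sum_(e <- L | e \in C)
    ((`[< exists x y, e = [set x; y] /\ A x y >])%:R : 'F_2)).
  rewrite [RHS]big_mkcond; apply: eq_bigr => e _; rewrite /edge_vec.
  by case: (e \in C); rewrite ?mulr1 ?mulr0.
rewrite -big_filter (perm_big [seq edge i | i <- enum 'I_n]) /=; last first.
  apply: uniq_perm; first exact: filter_uniq.
    by rewrite map_inj_uniq ?enum_uniq //; exact: cycle_edge_inj.
  move=> e; rewrite mem_filter; apply/andP/mapP => [[/set_mem[i _ <-] _]|[i _ ->]].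
    by exists i; rewrite ?mem_enum.
  have Ce : C (edge i) by exists i.
  by split; [exact: mem_set | exact: CL].
rewrite big_map big_enum /=; apply: eq_bigr => i _; congr (_ %:R); congr nat_of_bool.
apply/asbool_equiv_eq; split=> [[x [y [/edge_eq[[-> ->]|[-> ->]]]]]|Axy] //.
  exact: Asym.
by exists (c i), (c (ordS i)).
Qed.

Lemma even_short_cycles k : cycle_space G = linear_span (short_cycles G k) ->
  (forall n (c : 'I_n -> V), (3 <= n <= k)%N -> (forall i, G (c i) (c (ordS i))) ->
     \sum_(i < n) weight (c i) (c (ordS i)) = 0) ->
  forall n (c : 'I_n -> V), (3 <= n)%N -> injective c ->
    (forall i, G (c i) (c (ordS i))) ->
    \sum_(i < n) weight (c i) (c (ordS i)) = 0.
Proof.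
move=> gen short n c n3 cI cG; set C := [set [set c i; c (ordS i)] | i in [set: 'I_n]].
have finC m (d : 'I_m -> V) : finite_set [set [set d i; d (ordS i)] | i in [set: 'I_m]].
  by apply: finite_image; exact: finite_finset.
have : cycle_space G (edge_vec C).
  exists 1, (fun=> C); split=> [_|].
    by exists n; split=> //; exists c.
  congr edge_vec; apply/seteqP; split=> e.
    move=> Ce; rewrite /edge_sum /= (_ : [set i | _]%SET = [set ord0]%SET) ?cards1 //.
    by apply/setP => i; rewrite !inE (mem_set Ce) (ord1 i) eqxx.
  rewrite /edge_sum /=; case: (boolP (e \in C)) => [/set_mem //|nCe].
  by rewrite (_ : [set i | _]%SET = finset.set0) ?cards0 //;
    apply/setP => i; rewrite !inE (negbTE nCe).
rewrite gen => -[m [a [x [xS xE]]]].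
pose edges_of (D : {n & 'I_n -> V}) : set (set V) :=
  [set [set tagged D j; tagged D (ordS j)] | j in [set: 'I_(tag D)]].
pose short_cycle i (D : {n & 'I_n -> V}) : Prop :=
  [/\ (3 <= tag D <= k)%N, injective (tagged D),
      forall j, G (tagged D j) (tagged D (ordS j)) & x i = edge_vec (edges_of D)].
have [D DP] : {D & forall i, short_cycle i (D i)}.
  apply: choice => i.
  have [p [E [pk [p3 [d [dI dG EE]]] xE']]] := xS i.
  by exists (existT _ p d); rewrite /short_cycle /= p3 pk; split=> //; rewrite xE' EE.
pose U := C `|` \bigcup_(i in [set: 'I_m]) edges_of (D i).
have fU : finite_set U.
  rewrite finite_setU; split; first exact: finC.
  by apply: bigcup_finite => [|i _]; [exact: finite_finset | exact: finC].
have [L0 UE] := (@finite_seqP {classic (set V)} _).1 fU.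
pose L := undup L0; have uL : uniq L by exact: undup_uniq.
have UL e : U e -> (e : {classic (set V)}) \in L by rewrite mem_undup UE.
rewrite -(edge_functional_cycle n3 cI uL); last by move=> e Ce; apply: UL; left.
rewrite -/C xE /edge_functional fct_sumE.
under eq_bigr => e _ do rewrite mulr_sumr.
rewrite exchange_big big1 //= => i _.
have [/andP[Dn Dk] DI DG ->] := DP i.
under eq_bigr => e _ do rewrite mulrCA.
rewrite -mulr_sumr -/(edge_functional _ _) edge_functional_cycle //.
  by rewrite short ?mulr0 // Dn.
by move=> e Ce; apply: UL; right; exists i.
Qed.

(** A closed walk that repeats a vertex is made of two shorter ones; one that does
not is a cycle, unless it is trivial or runs back along a single edge. *)
Lemma even_closed_walks :
  (forall n (c : 'I_n -> V), (3 <= n)%N -> injective c ->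
     (forall i, G (c i) (c (ordS i))) -> \sum_(i < n) weight (c i) (c (ordS i)) = 0) ->
  forall n (c : nat -> V), c n = c 0%N -> (forall i, (i < n)%N -> G (c i) (c i.+1)) ->
    \sum_(i < n) weight (c i) (c i.+1) = 0.
Proof.
move=> cycles n; have [m] := ubnP n; elim: m n => // m IH n nm c cn cG.
have [[i [j [ij jn prop cij]]]|simple] := pselect (exists i j, [/\ (i < j)%N, (j <= n)%N,
    (j - i < n)%N & c i = c j]).
  (* [c2] skips the closed part of the walk between times [i] and [j]. *)
  pose d := (j - i)%N; have dE : (i + d = j)%N by rewrite subnKC // ltnW.
  have d0 : (0 < d)%N by rewrite subn_gt0.
  have inn : (i <= n - d)%N by rewrite leq_subRL ?(ltnW prop) // addnC dE.
  pose c2 t := if (t <= i)%N then c t else c (t + d)%N.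
  have c2i t : (i <= t)%N -> c2 t = c (t + d)%N.
    rewrite leq_eqVlt => /orP[/eqP <-|]; first by rewrite /c2 leqnn dE cij.
    by rewrite /c2 ltnNge => /negbTE ->.
  have c2l t : (t <= i)%N -> c2 t = c t by rewrite /c2 => ->.
  have S1 : \sum_(i <= t < j) weight (c t) (c t.+1) = 0.
    rewrite -[X in \sum_(X <= _ < _) _]add0n big_addn big_mkord -/d.
    rewrite (IH d _ (fun t => c (t + i)%N)) ?add0n 1?addnC ?dE //.
      by rewrite -ltnS (leq_trans _ nm) // ltnS.
    move=> t td; rewrite addSn; apply: cG.
    by rewrite (leq_trans _ jn) // -dE addnC ltn_add2l.
  have S2 : \sum_(0 <= t < n - d) weight (c2 t) (c2 t.+1) = 0.
    rewrite big_mkord; apply: IH.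
    - by rewrite -ltnS (leq_trans _ nm) // ltnS ltn_subrL d0 (leq_ltn_trans _ prop).
    - by rewrite c2i // subnK ?(ltnW prop) // c2l.
    move=> t tn; have [ti|it] := ltnP t i.
      rewrite !c2l ?(ltnW ti) //; apply: cG.
      by rewrite (leq_trans ti) // (leq_trans inn) // leq_subr.
    rewrite !c2i //; last exact: ltnW.
    by rewrite addSn; apply: cG; rewrite addnC -ltn_subRL.
  rewrite -(big_mkord xpredT (fun t => weight (c t) (c t.+1))).
  rewrite (big_cat_nat (leq0n i)) /=; last by rewrite (leq_trans (ltnW ij)).
  rewrite (big_cat_nat (ltnW ij) jn) /= S1 add0r -[RHS]S2.
  rewrite [RHS](big_cat_nat (leq0n i) inn) /=; congr (_ + _).
    by apply: eq_big_nat => t /andP[_ ti]; rewrite !c2l // ltnW.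
  rewrite -dE big_addn; apply: eq_big_nat => t /andP[it _].
  by rewrite !c2i // ltnW.
have cinj i j : (i < n)%N -> (j < n)%N -> c i = c j -> i = j.
  move=> iN jN e; case: (ltngtP i j) => // lt; case: simple.
    by exists i, j; split=> //; [exact: ltnW | rewrite (leq_ltn_trans (leq_subr _ _))].
  by exists j, i; split=> //; [exact: ltnW | rewrite (leq_ltn_trans (leq_subr _ _))].
case: n nm cn cG simple cinj => [|[|[|n]]] nm cn cG _ cinj.
- by rewrite big_ord0.
- by have := cG 0%N isT; rewrite cn => H; case: (adj_irrefl H).
- by rewrite 2!big_ord_recl big_ord0 /= addr0 cn weight_sym F2_addxx.
pose d (i : 'I_n.+3) := c i.
have dS (i : 'I_n.+3) : d (ordS i) = c i.+1.
  rewrite /d /=; have [lt|] := ltnP i.+1 n.+3; first by rewrite modn_small.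
  move=> ge; have -> : i.+1 = n.+3 by apply/eqP; rewrite eqn_leq ge ltn_ord.
  by rewrite modnn cn.
rewrite -[RHS](cycles n.+3 d) //; first by apply: eq_bigr => i _; rewrite dS.
- by move=> i j e; apply/val_inj/cinj => //; exact: ltn_ord.
- by move=> i; rewrite dS; apply: cG.
Qed.

Inductive walk (x : V) : 'F_2 -> V -> Prop :=
| walk_nil : walk x 0 x
| walk_step b y z : walk x b y -> G y z -> walk x (b + weight y z) z.

Lemma walk_trans x b y d z : walk x b y -> walk y d z -> walk x (b + d) z.
Proof.
move=> xy; elim=> [|e u v _ IH uv]; first by rewrite addr0.
by rewrite addrA; exact: walk_step.
Qed.

Lemma walk_sym x b y : walk x b y -> walk y b x.
Proof.
elim=> [|d u v _ IH uv]; first exact: walk_nil.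
rewrite addrC; apply: walk_trans IH; rewrite weight_sym -[weight _ _]add0r.
by apply: walk_step (walk_nil _) _; exact: adj_sym.
Qed.

Lemma walk_fun x b y : walk x b y -> exists n (c : nat -> V),
  [/\ c 0%N = x, c n = y, forall i, (i < n)%N -> G (c i) (c i.+1)
    & b = \sum_(i < n) weight (c i) (c i.+1)].
Proof.
elim=> [|d u v _ [n [c [c0 cn cG ->]]] uv].
  by exists 0%N, (fun=> x); split=> //; rewrite big_ord0.
exists n.+1, (fun t => if (t <= n)%N then c t else v); split=> //.
- by rewrite /= ltnn.
- move=> i; rewrite ltnS => lei; rewrite lei; have [lt|ge] := ltnP i n; first exact: cG.
  have -> : i = n by apply/eqP; rewrite eqn_leq lei.
  by rewrite cn.
- rewrite big_ord_recr /= leqnn ltnn cn; congr (_ + _).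
  by apply: eq_bigr => i _; rewrite ltn_ord ltnW.
Qed.

(** The vertices joined to [o] by walks with an odd number of edges of [A] form
the required side: by evenness of closed walks, all walks between two vertices
have the same parity. *)
Lemma even_closed_walks_cut o :
  (forall n (c : nat -> V), c n = c 0%N -> (forall i, (i < n)%N -> G (c i) (c i.+1)) ->
    \sum_(i < n) weight (c i) (c i.+1) = 0) ->
  exists R, forall x y, clos_refl_trans V G o x -> G x y -> (A x y <-> divides R x y).
Proof.
move=> even; have walk0 x b : walk x b x -> b = 0.
  by move=> /walk_fun[n [c [c0 cn cG ->]]]; apply: even; rewrite ?c0.
have walk_uniq x b d y : walk x b y -> walk x d y -> b = d.
  move=> xy /walk_sym yx; have /walk0 E := walk_trans xy yx.
  by rewrite -[b]addr0 -(F2_addxx d) addrA E add0r.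
exists [set y | walk o 1 y] => x y ox xy.
have [b ob] : exists b, walk o b x.
  have reach u v : clos_refl_trans V G u v ->
      (exists b, walk o b u) -> exists b, walk o b v.
    elim=> {u v} [u v uv [b ob]|//|u v z _ IH1 _ IH2 /IH1/IH2//].
    by exists (b + weight u v); exact: walk_step.
  by apply: reach ox _; exists 0; exact: walk_nil.
have oy := walk_step ob xy.
have RE z d : walk o d z -> [set y | walk o 1 y] z <-> d = 1.
  by move=> oz; split=> [/(walk_uniq _ _ _ _ oz)//|<-].
rewrite /divides (RE _ _ ob) (RE _ _ oy) /weight.
case: (asboolP (A x y)) => Axy; split=> //; first by move=> _; exact: F2_flip.
by rewrite addr0 => -[].
Qed.

End CycleParity.

Section ShortCycles.
Import GRing.Theory.
Variables (V : Type) (G : sgraph V) (k : nat).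

Lemma ball_le m n v x : m <= n -> ball G m v x -> ball G n v x.
Proof.
move=> mn; rewrite -(subnKC mn); elim: (n - m) => [|d IH]; first by rewrite addn0.
by move=> /IH; rewrite addnS; exact: ball_mono.
Qed.

Lemma cycle_in_ball n (c : 'I_n.+1 -> V) : (forall i, G (c i) (c (ordS i))) ->
  forall i, ball G n (c ord0) (c i).
Proof.
move=> cG i; apply: (@ball_le i); first by rewrite -ltnS ltn_ord.
case: i => m; elim: m => [|m IH] mn.
  by rewrite (_ : Ordinal mn = ord0) //; exact: val_inj.
right; exists (c (Ordinal (ltnW mn))); first exact: IH.
rewrite (_ : Ordinal mn = ordS (Ordinal (ltnW mn))) //.
by apply: val_inj; rewrite /= modn_small.
Qed.

(** A short cycle lies in a ball, where [A] is a cut, and it changes sides an even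
number of times. Linearity carries this over to all cycles. *)
Theorem short_cycles_local_cuts (A : V -> V -> Prop) :
  cycle_space G = linear_span (short_cycles G k) ->
  (forall x y, A x y -> A y x) ->
  (forall v, exists R, forall x y,
     ball G k v x -> ball G k v y -> G x y -> (A x y <-> divides R x y)) ->
  forall o, exists R, forall x y,
    clos_refl_trans V G o x -> G x y -> (A x y <-> divides R x y).
Proof.
move=> gen Asym loc o; apply: even_closed_walks_cut => //.
apply: even_closed_walks => //.
apply: even_short_cycles gen _ => // -[//|n] c /andP[_ nk] cG.
have [R RA] := loc (c ord0).
have ball_c i : ball G k (c ord0) (c i).
  by apply: ball_le (cycle_in_ball cG i); exact: ltnW.
pose side i : 'F_2 := ((`[< R (c i) >])%:R)%R.
rewrite (eq_bigr (fun i => side i + side (ordS i))%R) => [|i _]; last first.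
  rewrite /weight /side (asbool_equiv_eq (RA _ _ (ball_c i) (ball_c (ordS i)) (cG i))).
  rewrite (asbool_equiv_eq (dividesE _ _ _)) asbool_or !asbool_and !asbool_neg.
  by case: (asbool _); case: (asbool _); apply: val_inj.
by rewrite big_split /= [X in (X + _)%R](reindex_inj (@ordS_inj n.+1)) F2_addxx.
Qed.

End ShortCycles.

(** * Passing to a component *)

Section Component.
Variables (V : Type) (G : sgraph V) (o : V).

Definition vertex_component : set V := [set x | clos_refl_trans V G o x].

Definition component_vertex := {x : V | vertex_component x}.

Definition component_graph : sgraph component_vertex :=
  @SGraph component_vertex (fun u v => G (sval u) (sval v))
    (fun u v => @adj_sym _ G _ _) (fun u => @adj_irrefl _ G _).

Local Notation H := component_graph.

Lemma sval_component_inj : injective (@sval V vertex_component).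
Proof.
move=> [x ox] [y oy] /= xy; case: y / xy oy => oy; congr exist.
exact: Prop_irrelevance.
Qed.

Lemma component_closed x y : vertex_component x -> G x y -> vertex_component y.
Proof. by move=> ox xy; apply: rt_trans ox (rt_step _ _ _ _ xy). Qed.

Lemma component_ball k (u : component_vertex) y : ball G k (sval u) y ->
  exists2 v, sval v = y & ball H k u v.
Proof.
elim: k y => [y ->|k IH y]; first by exists u.
case=> [/IH[v vy uv]|[z /IH[v <- uv] vy]]; first by exists v => //; left.
exists (exist _ y (component_closed (svalP v) vy)) => //.
by right; exists v.
Qed.

Lemma reach_sym x y : clos_refl_trans V G x y -> clos_refl_trans V G y x.
Proof.
elim=> [u v uv|u|u v z _ vu _ zv];
  [|exact: rt_refl|exact: rt_trans zv vu].
by apply: rt_step; exact: adj_sym.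
Qed.

Lemma component_connected : connected_graph H.
Proof.
have lift x y : clos_refl_trans V G x y -> forall u : component_vertex, sval u = x ->
    exists2 v : component_vertex, sval v = y & clos_refl_trans _ H u v.
  elim=> [a b ab u ua|a u ua|a b c _ IH1 _ IH2 u /IH1[v /IH2[w wc vw] uv]].
  - have ob : vertex_component b by apply: component_closed ab; rewrite -ua; exact: svalP.
    by exists (exist _ b ob) => //; apply: rt_step; rewrite /= ua.
  - by exists u => //; exact: rt_refl.
  - by exists w => //; exact: rt_trans uv vw.
move=> u v; have uv : clos_refl_trans V G (sval u) (sval v).
  exact: rt_trans (reach_sym (svalP u)) (svalP v).
by have [w /sval_component_inj <-] := lift _ _ uv u erefl.
Qed.

Lemma component_locally_finite : locally_finite G -> locally_finite H.
Proof.
move=> Gf u; apply: (@finite_preimage _ _ [set y | G (sval u) y] sval) => //.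
by move=> v w _ _; exact: sval_component_inj.
Qed.

Lemma component_transitive : transitive_graph G -> transitive_graph H.
Proof.
move=> Gt u v; have [f [[[g fK gK] fG] fuv]] := Gt (sval u) (sval v).
have gG x y : G (g x) (g y) <-> G x y by rewrite -fG !gK.
have transport h x y : (forall x y, G (h x) (h y) <-> G x y) ->
    clos_refl_trans V G x y -> clos_refl_trans V G (h x) (h y).
  move=> hG; elim=> [a b /hG ab|a|a b c _ IH1 _ IH2].
  - exact: rt_step.
  - exact: rt_refl.
  - exact: rt_trans IH1 IH2.
have fP (w : component_vertex) : vertex_component (f (sval w)).
  apply: rt_trans (svalP v) _; rewrite -fuv; apply: transport => //.
  exact: rt_trans (reach_sym (svalP u)) (svalP w).
have gP (w : component_vertex) : vertex_component (g (sval w)).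
  apply: rt_trans (svalP u) _; rewrite -(fK (sval u)) fuv; apply: transport => //.
  exact: rt_trans (reach_sym (svalP v)) (svalP w).
exists (fun w => exist _ (f (sval w)) (fP w)); split; last exact: sval_component_inj.
split=> [|x y]; last exact: fG.
by exists (fun w => exist _ (g (sval w)) (gP w)) => w; apply: sval_component_inj;
  rewrite /= ?fK ?gK.
Qed.

(** A relation on the edges of the component, extended to the whole graph by no
edge outside, is still a cut in every ball. *)
Lemma component_cuts_local k :
  cycle_space G = linear_span (short_cycles G k) -> cuts_are_local H k.
Proof.
move=> gen A Asym loc.
pose A' x y := exists u v : component_vertex, [/\ sval u = x, sval v = y & A u v].
have A'E u v : A' (sval u) (sval v) <-> A u v.
  split=> [[a [b [/sval_component_inj -> /sval_component_inj ->]]]|] // Auv.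
  by exists u, v.
have [| |R RA] := short_cycles_local_cuts (A := A') gen _ _ o.
- by move=> x y [u [v [ux vy /Asym]]]; exists v, u.
- move=> x; have [ox|nox] := pselect (vertex_component x); last first.
    exists set0 => a b xa _ _; split; last by rewrite /divides => -[].
    move=> [u [v [ua _ _]]]; case: nox; have ou := svalP u; rewrite ua in ou.
    apply: rt_trans ou (reach_sym _).
    elim: k a xa {u v ua gen loc} => [a ->|k IH a [/IH//|[y /IH xy ya]]].
      exact: rt_refl.
    exact: rt_trans xy (rt_step _ _ _ _ ya).
  have [R RA] := loc (exist _ x ox); exists (sval @` R) => a b xa xb.
  have [u <- xu] := component_ball (u := exist _ x ox) xa.
  have [v <- xv] := component_ball (u := exist _ x ox) xb.
  have SE w : (sval @` R) (sval w) <-> R w.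
    by split=> [[t Rt /sval_component_inj <-]|] // Rw; exists w.
  move=> uv; rewrite /divides !SE A'E; exact: RA xu xv uv.
exists (sval @^-1` R) => u v uv; rewrite -A'E; exact: RA (svalP u) uv.
Qed.

End Component.

(** * Rays and ends *)

Section Rays.
Variables (V : Type) (G : sgraph V).
Implicit Types (r s : nat -> V) (S K : set V) (F : set (set V)).

Lemma finite_nat_bounded (P : set nat) : finite_set P ->
  exists N, forall n, N <= n -> ~ P n.
Proof.
move=> /finite_seqP[s ->]; exists (\max_(i <- s) i).+1 => n; rewrite ltnNge => /negP H ns.
by apply: H; apply: (@leq_bigmax_seq _ s xpredT id).
Qed.

Lemma eventually_inI r S K : eventually_in r S -> eventually_in r K ->
  eventually_in r (S `&` K).
Proof.
move=> [M HM] [N HN]; exists (maxn M N) => n; rewrite geq_max => /andP[Mn Nn].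
by split; [exact: HM | exact: HN].
Qed.

Lemma eventually_inS r S K : S `<=` K -> eventually_in r S -> eventually_in r K.
Proof. by move=> SK [N HN]; exists N => n /HN /SK. Qed.

Lemma eventually_in_inh r S : eventually_in r S -> exists n, S (r n).
Proof. by move=> [N HN]; exists N; exact: HN. Qed.

Lemma eventually_const r S N : (forall n, N <= n -> S (r n) <-> S (r n.+1)) ->
  eventually_in r S \/ eventually_in r (~` S).
Proof.
move=> const; have E n : N <= n -> S (r N) <-> S (r n).
  move=> /subnKC <-; elim: (n - N) => [|d IH]; first by rewrite addn0.
  by rewrite IH addnS; apply: const; exact: leq_addr.
have [SN|nSN] := pselect (S (r N)); [left|right]; exists N => n /E [H1 H2].
  exact: H1.
by move/H2.
Qed.

(** A ray uses each edge at most once, so it crosses a finite boundary only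
finitely often. *)
Lemma ray_side r S : is_ray G r -> finite_set (boundary G S) ->
  eventually_in r S \/ eventually_in r (~` S).
Proof.
move=> [rI rG] fS.
have fin (T : set V) : finite_set (boundary G T) ->
    finite_set [set n | boundary G T (r n, r n.+1)].
  move=> fT; apply: (finite_preimage (f := fun n => (r n, r n.+1)) _ fT).
  by move=> m n _ _ [/rI].
have [N noS] := finite_nat_bounded (fin _ fS).
have [N' noC] := finite_nat_bounded (fin _ (finite_boundaryC fS)).
apply: (@eventually_const _ _ (maxn N N')) => n; rewrite geq_max => /andP[Nn N'n].
split=> [Sn|Sn1]; apply: contrapT => nS.
  by apply: (noS n Nn); split; [exact: rG | split].
by apply: (noC n N'n); split; [exact: rG | split=> // /(_ Sn1)].
Qed.

Lemma component_trans F x y z :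
  component G F x y -> component G F y z -> component G F x z.
Proof. exact: rt_trans. Qed.

Lemma component_sym F x y : component G F x y -> component G F y x.
Proof.
elim=> [a b [ab nF]|a|a b c _ ba _ cb];
  [|exact: rt_refl|exact: component_trans cb ba].
by apply: rt_step; split; [exact: adj_sym | rewrite setUC].
Qed.

Lemma is_component_meet F K L x : is_component G F K -> is_component G F L ->
  K x -> L x -> K = L.
Proof.
move=> [a ->] [b ->] ax bx; apply/seteqP; split=> y.
  by move=> ay; apply: component_trans bx (component_trans (component_sym ax) ay).
by move=> ay; apply: component_trans ax (component_trans (component_sym bx) ay).
Qed.

Lemma component_side F S x y :
  (forall a b, G a b -> S a -> ~ S b -> F [set a; b]) ->
  component G F x y -> (S x <-> S y).
Proof.
move=> SF; elim=> [a b [ab nF]|a|a b c _ -> _ ->] //.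
split=> [Sa|Sb]; apply: contrapT => nS.
  by apply: nF; exact: SF.
by apply: nF; rewrite setUC; apply: SF => //; exact: adj_sym.
Qed.

Lemma ray_eventually_component r F : is_ray G r -> finite_set F ->
  exists2 K, is_component G F K & eventually_in r K.
Proof.
move=> [rI rG] fF.
have : finite_set [set n | F [set r n; r n.+1]].
  apply: (finite_preimage (f := fun n => [set r n; r n.+1]) _ fF).
  move=> m n _ _ /= E; have [[/rI//]|[/rI mn /rI nm]] := edge_eq E.
  by move: nm; rewrite mn => /eqP; rewrite gtn_eqF.
move=> /finite_nat_bounded[N noF]; exists (component G F (r N)); first by exists (r N).
exists N => n /subnKC <-; elim: (n - N) => [|d IH].
  by rewrite addn0; exact: rt_refl.
apply: component_trans IH _; rewrite addnS; apply: rt_step; split=> //.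
by apply: noF; exact: leq_addr.
Qed.

Lemma finite_boundary_component F x : F `<=` edges G -> finite_set F ->
  finite_set (boundary G (component G F x)).
Proof.
move=> FG fF; pose W := \bigcup_(e in F) e.
have fW : finite_set W.
  by apply: bigcup_finite => // e /FG[a [b [_ ->]]]; exact: finite_set2.
apply: sub_finite_set (finite_setX fW fW) => -[a b] [/= ab [xa nxb]].
have Fab : F [set a; b].
  apply: contrapT => nF; apply: nxb.
  exact: component_trans xa (rt_step _ _ _ _ (conj ab nF)).
by split; exists [set a; b] => //; [left|right].
Qed.

Lemma ray_equiv_trans r s t : ray_equiv G r s -> ray_equiv G s t -> ray_equiv G r t.
Proof.
move=> rs st F FG fF; have [K [cK rK sK]] := rs F FG fF.
have [L [cL sL tL]] := st F FG fF.
have [n [Kn Ln]] := eventually_in_inh (eventually_inI sK sL).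
by exists K; split=> //; rewrite (is_component_meet cK cL Kn Ln).
Qed.

Lemma ray_equiv_sym r s : ray_equiv G r s -> ray_equiv G s r.
Proof. by move=> rs F FG fF; have [K [cK rK sK]] := rs F FG fF; exists K. Qed.

Lemma inequivalent_rays_split r s : is_ray G r -> is_ray G s -> ~ ray_equiv G r s ->
  exists S, [/\ finite_set (boundary G S), eventually_in r S & eventually_in s (~` S)].
Proof.
move=> rr rs nrs; apply: contrapT => H; apply: nrs => F FG fF.
have [K cK rK] := ray_eventually_component rr fF; exists K; split=> //.
have fK : finite_set (boundary G K).
  by case: cK => x ->; exact: finite_boundary_component.
by have [//|sK] := ray_side rs fK; case: H; exists K.
Qed.

Lemma separates_ends r s S F : F `<=` edges G -> finite_set F ->
  (forall a b, G a b -> S a -> ~ S b -> F [set a; b]) ->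
  eventually_in r S -> eventually_in s (~` S) ->
  separates G F [set t | is_ray G t /\ ray_equiv G r t]
                [set t | is_ray G t /\ ray_equiv G s t].
Proof.
move=> FG fF SF rS sS r' s' [_ rr'] [_ ss'].
have [K [cK rK r'K]] := rr' F FG fF; have [L [cL sL s'L]] := ss' F FG fF.
exists K, L; split=> // KL; have [m [Km Sm]] := eventually_in_inh (eventually_inI rK rS).
have [n [Ln nSn]] := eventually_in_inh (eventually_inI sL sS).
apply: nSn; rewrite -KL in Ln; case: cK Km Ln => x -> xm xn.
by rewrite -(component_side SF xn) (component_side SF xm).
Qed.

Lemma ray_in_component o r n : is_ray G r -> vertex_component G o (r 0) ->
  vertex_component G o (r n).
Proof.
by move=> [_ rG] or0; elim: n => // n IH; exact: component_closed IH (rG n).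
Qed.

Lemma boundary_image_component o (S : set (component_vertex G o)) a b :
  boundary G (sval @` S) (a, b) ->
  exists u v, [/\ sval u = a, sval v = b & boundary (component_graph G o) S (u, v)].
Proof.
move=> [/= ab [[u Su ua] nSb]].
have ob : vertex_component G o b by apply: component_closed ab; rewrite -ua; exact: svalP.
exists u, (exist _ b ob); split=> //; split=> /=; first by rewrite ua.
by split=> // Sb; apply: nSb; exists (exist _ b ob).
Qed.

Lemma ray_ultrafilter o r : is_ray G r -> vertex_component G o (r 0) ->
  cut_ultrafilter (component_graph G o)
    [set S : set (component_vertex G o) | eventually_in r (sval @` S)].
Proof.
move=> rr or0; split=> /=.
- by move=> /eventually_in_inh[n [u]].
- move=> S T rS rT; apply: eventually_inS (eventually_inI rS rT) => x [[u Su ux] [v Tv vx]].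
  by exists u => //; split=> //; rewrite (sval_component_inj (etrans ux (esym vx))).
- by move=> S T ST; apply: eventually_inS => x [u /ST Tu <-]; exists u.
move=> S fS; have fS' : finite_set (boundary G (sval @` S)).
  apply: sub_finite_set (finite_image (fun p => (sval p.1, sval p.2)) fS) => -[a b].
  by move=> /boundary_image_component[u [v [<- <- uv]]]; exists (u, v).
have [|rS] := ray_side rr fS'; [by left | right].
have [N HN] := rS; exists N => n /HN nS.
by exists (exist _ (r n) (ray_in_component n rr or0)) => // Sn; apply: nS; eexists; eauto.
Qed.

End Rays.

Lemma card_le_II_card (T : Type) (A : set T) : finite_set A ->
  (A #<= `I_(card A))%card.
Proof.
move=> fA; have /finite_setP[n An] := fA.
by rewrite /card (@card_fset_set {classic T} A n An) (card_le_eql An) card_lexx.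
Qed.

(** * Accessibility *)

Theorem theorem1p2 (V : Type) (G : sgraph V)
  (Gfin : locally_finite G) (Gtrans : transitive_graph G)
  (Ggen : exists k : nat, cycle_space G = linear_span (short_cycles G k)) :
  accessible G.
Proof.
have [k gen] := Ggen.
have [[o]|noV] := pselect (inhabited V); last first.
  by exists 0 => w w' [r _ _]; case: noV; exact: inhabits (r 0).
have Hcon := component_connected (G := G) (o := o).
have [K boundK] := bounded_splitting Hcon (component_locally_finite (o := o) Gfin)
  (component_transitive (o := o) Gtrans) (component_cuts_local (o := o) gen)
  (exist _ o (rt_refl V G o)).
exists K => w w' [r rr ->] [s rs ->] neq.
have nrs : ~ ray_equiv G r s.
  move=> E; apply: neq; apply/seteqP; split=> t [rt Et]; split=> //.
    exact: ray_equiv_trans (ray_equiv_sym E) Et.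
  exact: ray_equiv_trans E Et.
have [S [fS rS sS]] := inequivalent_rays_split rr rs nrs.
(* Rays in different components are separated by the empty set. *)
have [sr|nsr] := pselect (vertex_component G (r 0) (s 0)); last first.
  exists set0; split; [by []|exact: card_ge0|].
  apply: (separates_ends (S := vertex_component G (r 0))) => //.
  - by move=> a b ab Sa; case; exact: component_closed ab.
  - by exists 0 => n _; apply: ray_in_component => //; exact: rt_refl.
  - exists 0 => n _ Sn; apply: nsr; apply: rt_trans Sn (reach_sym _).
    by apply: ray_in_component => //; exact: rt_refl.
have [f [[[g fK gK] fG] fo]] := Gtrans (r 0) o.
have f_ray t : is_ray G t -> is_ray G (f \o t).
  by move=> [tI tG]; split=> [m n /= /(can_inj fK)/tI//|n]; exact/fG.
have fr0 : vertex_component G o ((f \o r) 0) by rewrite /= fo; exact: rt_refl.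
have fs0 : vertex_component G o ((f \o s) 0).
  rewrite /vertex_component /= -fo.
  elim: sr => [a b ab|a|a b c _ IH1 _ IH2].
  - by apply: rt_step; apply/fG.
  - exact: rt_refl.
  - exact: rt_trans IH1 IH2.
pose X := component_vertex G o.
have tail t (A : set V) (B : set X) : is_ray G t -> vertex_component G o ((f \o t) 0) ->
    (forall u : X, A (g (sval u)) -> B u) ->
    eventually_in t A -> eventually_in (f \o t) (sval @` B).
  move=> rt t0 AB [N HN]; exists N => n /HN An.
  exists (exist _ (f (t n)) (ray_in_component n (f_ray _ rt) t0)) => //.
  by apply: AB; rewrite /= fK.
have [|T [fT rT sT] cT] := boundK _ _ (ray_ultrafilter (f_ray _ rr) fr0)
    (ray_ultrafilter (f_ray _ rs) fs0).
  exists [set u : X | S (g (sval u))]; split; last 2 first.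
  - by apply: tail rS.
  - by apply: tail sS.
  have gG x y : G (g x) (g y) <-> G x y by rewrite -fG !gK.
  apply: (sub_finite_set (B :=
    (fun p : X * X => (g (sval p.1), g (sval p.2))) @^-1` boundary G S)).
    by move=> p [/= /gG].
  apply: finite_preimage fS => -[u u'] [v v'] _ _ [E E'].
  by congr pair; apply: sval_component_inj; apply: (can_inj gK).
(* [T] separates the images of the rays under [f]; [g] moves its boundary back. *)
pose F := (fun p : X * X => [set g (sval p.1); g (sval p.2)]) @`
  boundary (component_graph G o) T.
have fF : finite_set F by exact: finite_image.
exists F; split.
- move=> _ [[u v] [/= uv _] <-]; exists (g (sval u)), (g (sval v)); split=> //.
  by apply/fG; rewrite !gK.
- apply: card_le_trans (card_image_le _ _) _.
  by apply: card_le_trans (card_le_II_card fT) _; rewrite card_le_II.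
apply: (separates_ends (S := f @^-1` (sval @` T))) => //.
- move=> _ [[u v] [/= uv _] <-]; exists (g (sval u)), (g (sval v)); split=> //.
  by apply/fG; rewrite !gK.
- move=> a b /fG ab Ta nTb.
  have [u [v [ua vb Tuv]]] : exists u v, [/\ sval u = f a, sval v = f b &
      boundary (component_graph G o) T (u, v)] by exact: boundary_image_component.
  by exists (u, v) => //=; rewrite ua vb !fK.
- have [N HN] := sT; exists N => n /HN [u nTu uE] [v Tv vE].
  by apply: nTu; rewrite (sval_component_inj (etrans uE (esym vE))).
Qed.
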